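(* Let $X,U$ be Hilbert spaces, let $A:D(A)\to X$ generate a $C_0$-semigroup $(S(t))_{t\ge 0}$ on $X$, and let $B\in L(U,X)$. Let $T>0$ be arbitrary. The following are equivalent: (i) The control system $\dot y(t)=Ay(t)+Bu(t)$ is approximately null controllable in time $T$. (ii) For every $y_0\in X$ and every $\alpha>0$, $\mu_{y_0,\alpha}^T<+\infty$. (iii) For every $y_0\in X$ and every $\alpha>0$, there exists $C>0$ such that $$\langle\psi,S(T)y_0\rangle_X\le C\,\Vert B^*S(T-\cdot)^*\psi\Vert_{L^2(0,T;U)}+\alpha\Vert y_0\Vert_X\Vert\psi\Vert_X\qquad\forall\psi\in X.$$ Moreover, when one of these items is satisfied, for every $y_0\in X$ and every $\alpha>0$ the smallest constant $C\ge 0$ for which the inequality in (iii) holds for all $\psi\in X$ is $C=\mu_{y_0,\alpha}^T$.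
   Context: $X$ and $U$ are identified with their duals. In inequalities, $\langle\cdot,\cdot\rangle_X$ is the real scalar product (the real part of the inner product if $X$ is complex). For $y_0\in X$ and $u\in L^2(0,T;U)$, the solution of $\dot y=Ay+Bu$, $y(0)=y_0$, is the mild solution $y(T;y_0,u)=S(T)y_0+\int_0^TS(T-t)Bu(t)\,dt$. The system is approximately null controllable in time $T$ if for every $\varepsilon>0$ and every $y_0\in X$ there exists $u\in L^2(0,T;U)$ such that $\Vert y(T;y_0,u)\Vert_X\le\varepsilon$. Notation: $\Vert B^*S(T-\cdot)^*\psi\Vert_{L^2(0,T;U)}=\left(\int_0^T\Vert B^*S(T-t)^*\psi\Vert_U^2\,dt\right)^{1/2}$, and $$\mu_{y_0,\alpha}^T=\inf\left\{C\ge 0\ \mid\ \langle\psi,S(T)y_0\rangle_X-\alpha\Vert y_0\Vert_X\Vert\psi\Vert_X\le C\,\Vert B^*S(T-\cdot)^*\psi\Vert_{L^2(0,T;U)}\ \ \forall\psi\in X\right\}\in[0,+\infty],$$ with the convention $\inf\emptyset=+\infty$. *)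

(* Defs.v *)
From HB Require Import structures.
From mathcomp Require Import all_boot all_order all_algebra sesquilinear.
From mathcomp Require Import complex.
From mathcomp Require Import all_classical all_reals all_analysis.
Set Implicit Arguments.
Unset Strict Implicit.
Unset Printing Implicit Defensive.
Import Order.TTheory GRing.Theory Num.Theory.
Import numFieldNormedType.Exports.
Local Open Scope classical_set_scope.
Local Open Scope ring_scope.

(* Hilbert spaces are taken over R or over R[i]; [scalar R k] is the field
   selected by [k], so that both cases share all the definitions below. *)
Variant scalar_kind := RealScalars | ComplexScalars.

Definition scalar (R : realType) (k : scalar_kind) : numFieldType :=
  match k with
  | RealScalars => (R : numFieldType)
  | ComplexScalars => (R[i] : numFieldType)
  end.

Definition scalar_conj (R : realType) (k : scalar_kind) :
    scalar R k -> scalar R k :=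
  match k with
  | RealScalars => idfun
  | ComplexScalars => fun z : R[i] => z^*
  end.

Definition scalar_re (R : realType) (k : scalar_kind) : scalar R k -> R :=
  match k with
  | RealScalars => idfun
  | ComplexScalars => fun z : R[i] => complex.Re z
  end.

Definition of_real (R : realType) (k : scalar_kind) : R -> scalar R k :=
  match k with
  | RealScalars => idfun
  | ComplexScalars => fun x : R => (x%:C)%C
  end.
Arguments of_real {R} k _.

HB.mixin Record isHilbert (R : realType) (k : scalar_kind) (V : Type)
    of CompleteNormedModule (scalar R k) V := {
  inner : {dot V for @scalar_conj R k} ;
  inner_norm : forall x : V, inner x x = `|x| ^+ 2
}.

#[short(type="hilbertType")]
HB.structure Definition Hilbert (R : realType) (k : scalar_kind) :=
  { V of isHilbert R k V & CompleteNormedModule (scalar R k) V }.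

Section Hilbert_operators.
Context {R : realType} {k : scalar_kind}.

(* the library's norm [`|x|] is [scalar R k]-valued; this is the same norm
   as an element of R *)
Definition rnorm (V : hilbertType R k) (x : V) : R := scalar_re `|x|.

Definition rinner (V : hilbertType R k) (x y : V) : R :=
  scalar_re (inner x y).

(* For f linear and continuous the adjoint exists everywhere (Riesz) and is
   unique; the default value 0 is never used in that case. *)
Definition adjoint (V W : hilbertType R k) (f : V -> W) (w : W) : V :=
  xget 0 [set v | forall z : V, inner (f z) w = inner z v].

Definition C0_semigroup (X : hilbertType R k) (S : R -> X -> X) : Prop :=
  [/\ forall t, 0 <= t -> linear (S t) /\ continuous (S t),
      S 0 =1 id,
      forall s t x, 0 <= s -> 0 <= t -> S (s + t) x = S s (S t x)
    & forall x, S t x @[t --> 0^'+] --> x].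

(* The operator A : D -> X is represented by a total function whose values
   outside D are irrelevant. *)
Definition generates (X : hilbertType R k) (D : set X) (A : X -> X)
    (S : R -> X -> X) : Prop :=
  [/\ C0_semigroup S,
      D = [set x | cvg (of_real k t^-1 *: (S t x - x) @[t --> 0^'+])]
    & forall x, D x -> of_real k t^-1 *: (S t x - x) @[t --> 0^'+] --> A x].

End Hilbert_operators.

Section Bochner.
Context {R : realType} {k : scalar_kind} {V : hilbertType R k}.
Variable T : R.

Let mu := @lebesgue_measure R.

Definition simple (s : {fimfun R >-> V}) : Prop :=
  forall v, measurable (s @^-1` [set v]).

Definition simple_integral (s : {fimfun R >-> V}) : V :=
  \sum_(v \in range s)
     of_real k (fine (mu (`[0, T] `&` s @^-1` [set v]))) *: v.

(* Measurability is with respect to Borel sets and convergence holds at every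
   point of [0, T]; every Bochner-measurable class of functions modulo
   Lebesgue-null sets has such a representative. *)
Definition strongly_measurable (f : R -> V) : Prop :=
  exists s : {fimfun R >-> V}^nat, (forall n, simple (s n)) /\
    forall t, t \in `[0, T] -> s n t @[n --> \oo] --> f t.

Definition is_bochner_integral (f : R -> V) (v : V) : Prop :=
  strongly_measurable f /\
  exists s : {fimfun R >-> V}^nat,
    [/\ forall n, simple (s n),
        (\int[mu]_(t in `[0%R, T]) (rnorm (f t - s n t))%:E)%E
          @[n --> \oo] --> 0%E
      & simple_integral (s n) @[n --> \oo] --> v].

Definition bochner_integral (f : R -> V) : V :=
  xget 0 [set v | is_bochner_integral f v].

Definition L2 (f : R -> V) : Prop :=
  strongly_measurable f /\
  (\int[mu]_(t in `[0%R, T]) (rnorm (f t) ^+ 2)%:E < +oo)%E.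

Definition L2norm (f : R -> V) : R :=
  Num.sqrt (\int[mu]_(t in `[0, T]) (rnorm (f t) ^+ 2)).

End Bochner.

Section Control.
Context {R : realType} {k : scalar_kind} {X U : hilbertType R k}.
Variables (S : R -> X -> X) (B : U -> X) (T : R).

Definition mild_solution (y0 : X) (u : R -> U) : X :=
  S T y0 + bochner_integral T (fun t => S (T - t) (B (u t))).

Definition approx_null_controllable : Prop :=
  forall (eps : R) (y0 : X), 0 < eps ->
    exists u : R -> U, L2 T u /\ rnorm (mild_solution y0 u) <= eps.

Definition observation (psi : X) (t : R) : U :=
  adjoint B (adjoint (S (T - t)) psi).

Definition mu_cost (y0 : X) (alpha : R) : \bar R :=
  ereal_inf [set C%:E | C in [set C : R | 0 <= C /\ forall psi : X,
    rinner psi (S T y0) - alpha * rnorm y0 * rnorm psi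
      <= C * L2norm T (observation psi)]].

Definition observability (y0 : X) (alpha C : R) : Prop :=
  forall psi : X, rinner psi (S T y0)
    <= C * L2norm T (observation psi) + alpha * rnorm y0 * rnorm psi.

End Control.

(* Main.v *)
(* (i) => (iii): if [u] steers [y0] to within [alpha |y0|], then
   <psi, S(T) y0> = <psi, y(T)> - int <B^* S(T-t)^* psi, u(t)> dt, and
   Cauchy-Schwarz bounds the last integral by |u| |B^* S(T-.)^* psi|.

   (iii) => (i): let M be the subspace of the states reached from 0 by simple
   controls and w the component of S(T) y0 orthogonal to M.  Orthogonality to
   the states reached by [z 1_[a,b]] and continuity of t |-> S(T-t) B z give
   B^* S(T-t)^* w = 0 for every t, so that (iii) at psi = w reads
   |w|^2 <= alpha |y0| |w|.  Hence |w| <= alpha |y0| for every alpha > 0, while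
   M contains points arbitrarily close to S(T) y0 - w.

   The integral of |B^* S(T-.)^* psi|^2 only occurs as an upper bound, where its
   reading as a lower integral suffices; this replaces the measurability of
   t |-> B^* S(T-t)^* psi, which would need Pettis' theorem. *)
Require Import Defs.
From HB Require Import structures.
From mathcomp Require Import all_boot all_order all_algebra sesquilinear.
From mathcomp Require Import complex.
From mathcomp Require Import all_classical all_reals all_analysis.
From mathcomp Require Import measurable_realfun ring lra.
Set Implicit Arguments.
Unset Strict Implicit.
Unset Printing Implicit Defensive.
Import Order.TTheory GRing.Theory Num.Theory.
Import numFieldNormedType.Exports.
Local Open Scope classical_set_scope.
Local Open Scope ring_scope.

(** * Scalars and the real inner product *)

(** Two analytic facts must come out of strong continuity alone: t |-> S(T-t) B z has a Bochner
    integral, and the observation is bounded on [0, T]. Both rest on a bound of S(t) uniform in t <=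
    T, hence on the uniform boundedness principle. The second fact matters because [L2norm] takes
    [fine] of an extended integral: an infinite value would be read as 0 and the upper bound in
    (iii) would be lost.

    Uniqueness of Bochner integrals and linearity of [simple_integral] are reduced to real integrals
    by pairing with a vector psi. Orthogonality is taken for [rinner], so real combinations of
    reachable states suffice even over R[i]; the full inner product enters only through the Riesz
    theorem behind [adjoint]. As M need not be closed, the component w is a limit of residuals z -
    m, and every use of it goes through approximations by points of M. *)

Lemma invr_truncn_le (R : realType) (e : R) (n : nat) :
  0 < e -> (Num.truncn e^-1 <= n)%N -> n.+1%:R^-1 <= e.
Proof.
move=> e0 hn; rewrite -(invrK e) lef_pV2 ?posrE ?invr_gt0//.
by rewrite (le_trans (ltW (truncnS_gt _)))// ler_nat.
Qed.

Section scalars.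
Context (R : realType) (k : scalar_kind).
Local Notation K := (Defs.scalar R k).
Local Notation re := (@scalar_re R k).

Lemma scalar_reD (x y : K) : re (x + y) = re x + re y.
Proof. by case: k x y => //= -[a b] [c d]. Qed.

Lemma scalar_reN (x : K) : re (- x) = - re x.
Proof. by case: k x => //= -[a b]. Qed.

Lemma scalar_re0 : re 0 = 0.
Proof. by case: k. Qed.

Lemma scalar_re1 : re 1 = 1.
Proof. by case: k. Qed.

Lemma scalar_re_of_real (a : R) : re (of_real k a) = a.
Proof. by case: k. Qed.

Lemma scalar_re_ofM (a : R) (x : K) : re (of_real k a * x) = a * re x.
Proof. by case: k x => //= -[c d] /=; rewrite mul0r subr0. Qed.

Lemma scalar_conj_of_real (a : R) : scalar_conj (of_real k a) = of_real k a.
Proof. by case: k => //=; apply/eqP; rewrite eq_complex /= oppr0 !eqxx. Qed.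

Lemma scalar_conjK (x : K) : scalar_conj (scalar_conj x) = x.
Proof. by case: k x => //= x; rewrite conjCK. Qed.

Lemma scalar_conjM (x y : K) : scalar_conj (x * y) = scalar_conj x * scalar_conj y.
Proof. by case: k x y => //= x y; rewrite rmorphM. Qed.

Lemma scalar_re_conj (x : K) : re (scalar_conj x) = re x.
Proof. by case: k x => //= -[a b]. Qed.

Lemma of_real0 : of_real k 0 = 0 :> K.
Proof. by case: k. Qed.

Lemma of_real1 : of_real k 1 = 1 :> K.
Proof. by case: k. Qed.

Lemma of_realN (a : R) : of_real k (- a) = - of_real k a :> K.
Proof. by case: k => //=; rewrite rmorphN. Qed.

Lemma of_realM (a b : R) : of_real k (a * b) = of_real k a * of_real k b :> K.
Proof. by case: k => //=; rewrite rmorphM. Qed.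

Lemma ler_of_real (a b : R) : (of_real k a <= of_real k b :> K) = (a <= b).
Proof. by case: k => //=; rewrite lecR. Qed.

Lemma ltr_of_real (a b : R) : (of_real k a < of_real k b :> K) = (a < b).
Proof. by case: k => //=; rewrite ltcR. Qed.

Lemma of_real_re (x : K) : 0 <= x -> of_real k (re x) = x.
Proof.
case: k x => //= -[a b]; rewrite lecE /= => /andP[/eqP e _].
by apply/eqP; rewrite eq_complex /= e !eqxx.
Qed.

Lemma of_real_norm (a : R) : `|of_real k a| = of_real k `|a| :> K.
Proof. by case: k => //=; apply/eqP; rewrite eq_complex /= expr0n addr0 sqrtr_sqr !eqxx. Qed.

Lemma scalar_re_norm_ge0 (x : K) : 0 <= re `|x|.
Proof. by rewrite -ler_of_real of_real0 of_real_re. Qed.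

Lemma scalar_re_norm_le0 (x : K) : re `|x| <= 0 -> x = 0.
Proof.
move=> h; apply/eqP; rewrite -normr_eq0 -(@of_real_re `|x|)//.
by rewrite (_ : re `|x| = 0) ?of_real0//; apply/le_anti; rewrite h scalar_re_norm_ge0.
Qed.

Lemma scalar_eq0 (w : K) : (forall c, re (c * w) = 0) -> w = 0.
Proof.
move=> h; apply/eqP; apply: contraT => w0.
by have := h w^-1; rewrite mulVf// scalar_re1 => /eqP; rewrite oner_eq0.
Qed.

End scalars.

Section hilbert.
Context (R : realType) (k : scalar_kind).
Local Notation K := (Defs.scalar R k).
Implicit Types V : hilbertType R k.

Lemma innerC V (x y : V) : inner x y = scalar_conj (inner y x).
Proof. by rewrite {1}hermitian_subproof /= expr0 mul1r. Qed.

Lemma rinnerC V (x y : V) : rinner x y = rinner y x.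
Proof. by rewrite /rinner innerC scalar_re_conj. Qed.

Lemma rinnerDl V (x y z : V) : rinner (x + y) z = rinner x z + rinner y z.
Proof. by rewrite /rinner linearDl scalar_reD. Qed.

Lemma rinnerDr V (x y z : V) : rinner z (x + y) = rinner z x + rinner z y.
Proof. by rewrite rinnerC rinnerDl !(rinnerC z). Qed.

Lemma rinnerNl V (x z : V) : rinner (- x) z = - rinner x z.
Proof. by rewrite /rinner linearNl scalar_reN. Qed.

Lemma rinnerNr V (x z : V) : rinner z (- x) = - rinner z x.
Proof. by rewrite rinnerC rinnerNl rinnerC. Qed.

Lemma rinner0l V (z : V) : rinner 0 z = 0.
Proof. by rewrite /rinner linear0l scalar_re0. Qed.

Lemma rinner0r V (z : V) : rinner z 0 = 0.
Proof. by rewrite rinnerC rinner0l. Qed.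

Lemma rinnerZl V (a : R) (x z : V) : rinner (of_real k a *: x) z = a * rinner x z.
Proof. by rewrite /rinner linearZl_LR scalar_re_ofM. Qed.

Lemma rinnerZr V (a : R) (x z : V) : rinner z (of_real k a *: x) = a * rinner z x.
Proof. by rewrite rinnerC rinnerZl rinnerC. Qed.

Lemma rinner_suml V (I : Type) (r : seq I) (P : pred I) (F : I -> V) z :
  rinner (\sum_(i <- r | P i) F i) z = \sum_(i <- r | P i) rinner (F i) z.
Proof.
by apply: (big_morph (fun x => rinner x z)) => [x y|]; rewrite ?rinnerDl ?rinner0l.
Qed.

Lemma normE V (x : V) : `|x| = of_real k (rnorm x).
Proof. by rewrite of_real_re. Qed.

Lemma rnorm_ge0 V (x : V) : 0 <= rnorm x.
Proof. by rewrite -(ler_of_real k) -normE of_real0. Qed.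

Lemma rnorm0 V : rnorm (0 : V) = 0.
Proof. by rewrite /rnorm normr0 scalar_re0. Qed.

Lemma rnorm_eq0 V (x : V) : (rnorm x == 0) = (x == 0).
Proof.
apply/idP/idP => [/eqP h|/eqP ->]; last by rewrite rnorm0.
by rewrite -normr_eq0 normE h of_real0.
Qed.

Lemma rnormN V (x : V) : rnorm (- x) = rnorm x.
Proof. by rewrite /rnorm normrN. Qed.

Lemma rdistC V (x y : V) : rnorm (x - y) = rnorm (y - x).
Proof. by rewrite -opprB rnormN. Qed.

Lemma of_realD (a b : R) : of_real k (a + b) = of_real k a + of_real k b :> K.
Proof. by case: k => //=; rewrite rmorphD. Qed.

Lemma ler_rnormD V (x y : V) : rnorm (x + y) <= rnorm x + rnorm y.
Proof. by rewrite -(ler_of_real k) of_realD -!normE ler_normD. Qed.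

Lemma ler_rnorm_add V (x y : V) : rnorm x <= rnorm y + rnorm (x - y).
Proof. by rewrite -{1}(subrK y x) addrC; exact: ler_rnormD. Qed.

Lemma rnormZ V (a : R) (x : V) : rnorm (of_real k a *: x) = `|a| * rnorm x.
Proof. by rewrite /rnorm normrZ of_real_norm scalar_re_ofM. Qed.

Lemma rinnerxx V (x : V) : rinner x x = rnorm x ^+ 2.
Proof.
rewrite /rinner inner_norm normE.
by rewrite expr2 scalar_re_ofM scalar_re_of_real.
Qed.

Lemma rnorm_sqrD V (x y : V) :
  rnorm (x + y) ^+ 2 = rnorm x ^+ 2 + rinner x y *+ 2 + rnorm y ^+ 2.
Proof.
by rewrite -!rinnerxx !(rinnerDl, rinnerDr) (rinnerC y x) mulr2n !addrA.
Qed.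

Lemma ler_rinner V (x y : V) : `|rinner x y| <= rnorm x * rnorm y.
Proof.
have h (z w : V) : rinner z w <= rnorm z * rnorm w.
  have [w0|w0] := eqVneq (rnorm w) 0.
    have /eqP -> : w == 0 by rewrite -rnorm_eq0 w0 eqxx.
    by rewrite rinner0r rnorm0 mulr0.
  have [z0|z0] := eqVneq (rnorm z) 0.
    have /eqP -> : z == 0 by rewrite -rnorm_eq0 z0 eqxx.
    by rewrite rinner0l rnorm0 mul0r.
  have wp : 0 < rnorm w by rewrite lt0r w0 rnorm_ge0.
  have zp : 0 < rnorm z by rewrite lt0r z0 rnorm_ge0.
  (* Expanding the square of |w| z - |z| w leaves 2 |w| |z| (|w| |z| - <z, w>) >= 0. *)
  have := sqr_ge0 (rnorm (of_real k (rnorm w) *: z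
                          + of_real k (- rnorm z) *: w)).
  rewrite rnorm_sqrD !rnormZ rinnerZl rinnerZr normrN !ger0_norm ?rnorm_ge0//.
  move=> H.
  have {}H : 0 <= (rnorm w * rnorm z) * ((rnorm z * rnorm w) - rinner z w).
    by lra.
  by rewrite pmulr_rge0 ?mulr_gt0// subr_ge0 in H.
rewrite ler_norml h andbT lerNl -rinnerNl -(rnormN x); exact: h.
Qed.

(** Multiplying x by the unimodular scalar |h| / h keeps its norm and makes the inner product equal
    to |h|, which reduces the claim to the real Cauchy-Schwarz inequality. *)
Lemma ler_inner V (x y : V) : scalar_re `|inner x y| <= rnorm x * rnorm y.
Proof.
set h := inner x y; have [h0|h0] := eqVneq h 0.
  by rewrite h0 normr0 scalar_re0 mulr_ge0 ?rnorm_ge0.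
have -> : rnorm x = rnorm ((`|h| / h) *: x).
  by rewrite /rnorm normrZ normrM normrV ?unitfE// normr_id divff ?normr_eq0// mul1r.
apply: le_trans (ler_rinner _ _); apply: le_trans (ler_norm _).
by rewrite /rinner linearZl_LR /= divfK.
Qed.

Lemma rinner_inj V (x y : V) : (forall z, rinner z x = rinner z y) -> x = y.
Proof.
move=> h; apply/eqP; rewrite -subr_eq0 -rnorm_eq0 -sqrf_eq0 -rinnerxx.
by rewrite rinnerDr rinnerNr h subrr.
Qed.

(** Balls have radii in [scalar R k], but a positive scalar is the image of a real number
    ([of_real_re]), so convergence can be tested with real radii. *)
Lemma cvg_rnorm (T : Type) (F : set_system T) {FF : Filter F} V (f : T -> V) l :
  f @ F --> l <-> rnorm (l - f x) @[x --> F] --> 0.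
Proof.
split=> [/cvgrPdist_lt h|/cvgrPdist_lt h].
  apply/cvgrPdist_lt => e e0.
  have : 0 < of_real k e :> K by rewrite -(of_real0 R) ltr_of_real.
  move=> /h; apply: filterS => x; rewrite normE ltr_of_real sub0r normrN.
  by rewrite ger0_norm ?rnorm_ge0.
apply/cvgrPdist_lt => e e0.
have e0' := of_real_re (ltW e0).
have : 0 < scalar_re e by rewrite -(ltr_of_real k) e0' of_real0.
move=> /h; apply: filterS => x; rewrite sub0r normrN.
by rewrite ger0_norm ?rnorm_ge0// normE -(ltr_of_real k) e0'.
Qed.

Lemma cvg_rnorm_lt (T : Type) (F : set_system T) {FF : Filter F} V (f : T -> V) l :
  f @ F --> l <-> forall e : R, 0 < e -> \forall x \near F, rnorm (l - f x) < e.
Proof.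
rewrite cvg_rnorm; split=> [/cvgrPdist_lt h e /h|h].
  by apply: filterS => x; rewrite sub0r normrN ger0_norm ?rnorm_ge0.
apply/cvgrPdist_lt => e /h; apply: filterS => x.
by rewrite sub0r normrN ger0_norm ?rnorm_ge0.
Qed.

Lemma rnorm_complete V (u : nat -> V) :
  (forall e : R, 0 < e -> exists N, forall n m, (N <= n)%N -> (N <= m)%N ->
     rnorm (u n - u m) <= e) ->
  exists l : V, u n @[n --> \oo] --> l.
Proof.
move=> h; apply/cvg_ex/cauchy_cvgP/cauchy_exP => e e0.
have e0' := of_real_re (ltW e0).
have re0 : 0 < scalar_re e by rewrite -(ltr_of_real k) e0' of_real0.
(* Half the radius, since the hypothesis gives a weak inequality and the ball requires a strict
   one. *)
have [N hN] := h _ (divr_gt0 re0 (ltr0Sn R 1)).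
exists (u N); exists N => //= n /= Nn.
rewrite -ball_normE /ball_ /= normE -e0' ltr_of_real.
apply: le_lt_trans (hN _ _ (leqnn N) Nn) _.
by rewrite ltr_pdivrMr// ltr_pMr// ltr1n.
Qed.

End hilbert.

(** * Orthogonal projection, Riesz representation and adjoints *)

Section projection.
Context (R : realType) (k : scalar_kind) (V : hilbertType R k).
Local Notation K := (Defs.scalar R k).

Lemma rnorm_parallelogram (x y : V) :
  rnorm (x + y) ^+ 2 + rnorm (x - y) ^+ 2 = rnorm x ^+ 2 *+ 2 + rnorm y ^+ 2 *+ 2.
Proof. by rewrite !rnorm_sqrD rnormN rinnerNr; lra. Qed.

(** The quadratic t |-> |w - t m|^2 is minimal at 0, so its slope -2 <w, m> there vanishes. The test
    value t = a / b has b = |m|^2 + 1 instead of |m|^2, which covers m = 0. *)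
Lemma rinner_eq0_of_min (w m : V) :
  (forall t : R, rnorm w <= rnorm (w - of_real k t *: m)) -> rinner w m = 0.
Proof.
set a := rinner w m; set b := rnorm m ^+ 2 + 1 => h.
have b0 : 0 < b by rewrite ltr_wpDl ?sqr_ge0.
have := h (a / b); rewrite -ler_sqr ?nnegrE ?rnorm_ge0//.
rewrite rnorm_sqrD rnormN rnormZ exprMn real_normK ?num_real// rinnerNr rinnerZr.
rewrite -/a (_ : rnorm m ^+ 2 = b - 1); last by rewrite /b addrK.
move=> H; have {}H : a ^+ 2 * (b + 1) / b ^+ 2 <= 0.
  have -> : a ^+ 2 * (b + 1) / b ^+ 2
      = - ((- (a / b * a)) *+ 2 + (a / b) ^+ 2 * (b - 1)).
    by field; rewrite gt_eqF.
  by lra.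
apply/eqP; rewrite -sqrf_eq0; apply/eqP/le_anti; rewrite sqr_ge0 andbT.
have B0 : 0 < (b + 1) / b ^+ 2 by apply: divr_gt0; [exact: addr_gt0|exact: exprn_gt0].
by rewrite -mulrA pmulr_lle0 in H.
Qed.

(** A sequence in M minimizing the distance to z is Cauchy by the parallelogram law; w is z minus
    its limit. The limit may lie outside M, hence the approximate second clause. *)
Lemma orthogonal_projection (M : set V) (z : V) :
  M 0 -> (forall x y, M x -> M y -> M (x + y)) ->
  (forall a x, M x -> M (of_real k a *: x)) ->
  exists w, (forall m, M m -> rinner w m = 0) /\
    forall e : R, 0 < e -> exists2 m, M m & rnorm (z - m - w) <= e.
Proof.
move=> M0 MD MZ.
pose E := [set rnorm (z - m) | m in M]; pose d := inf E.
have E0 : E (rnorm (z - 0)) by exists 0.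
have Elb : has_inf E.
  by split; [exists (rnorm (z - 0))|exists 0 => _ [m _ <-]; exact: rnorm_ge0].
have dlb m : M m -> d <= rnorm (z - m).
  by move=> Mm; apply: ge_inf; [case: Elb|exists m].
have d0 : 0 <= d.
  by apply: lb_le_inf; [case: Elb|move=> _ [m _ <-]; exact: rnorm_ge0].
have /choice[u hu] (n : nat) : exists m, M m /\ rnorm (z - m) < d + n.+1%:R^-1.
  have n0 : 0 < n.+1%:R^-1 :> R by rewrite invr_gt0 ltr0n.
  have [_ [m Mm <-] hm] := inf_adherent n0 Elb.
  by exists m.
have ucauchy (e : R) : 0 < e -> exists N, forall n m, (N <= n)%N -> (N <= m)%N ->
    rnorm (u n - u m) <= e.
  (* The parallelogram law will give |u n - u m|^2 <= 4 (d + eta)^2 - 4 d^2 = 8 d eta + 4 eta^2,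
     which is at most eta (8 d + 4) as eta <= 1. *)
  move=> e0; pose eta := Num.min 1 (e ^+ 2 / (8 * d + 4)).
  have D0 : 0 < 8 * d + 4 by lra.
  have eta0 : 0 < eta by rewrite lt_min ltr01 divr_gt0// exprn_gt0.
  have hN n := @invr_truncn_le R eta n eta0.
  exists (Num.truncn eta^-1) => n m Nn Nm.
  have eta1 : eta <= 1 by rewrite ge_min lexx.
  have etae : eta * (8 * d + 4) <= e ^+ 2.
    by rewrite -ler_pdivlMr// ge_min lexx orbT.
  have [Mn hn] := hu n; have [Mm hm] := hu m.
  have {}hn : rnorm (z - u n) <= d + eta.
    by apply: (le_trans (ltW hn)); rewrite lerD2l hN.
  have {}hm : rnorm (z - u m) <= d + eta.
    by apply: (le_trans (ltW hm)); rewrite lerD2l hN.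
  (* The midpoint of [u n] and [u m] lies in M, hence at distance at least d from z. *)
  have hmid : d * 2 <= rnorm ((z - u n) + (z - u m)).
    have -> : z - u n + (z - u m)
       = of_real k 2 *: (z - of_real k 2^-1 *: (u n + u m)).
      rewrite scalerBr scalerA -of_realM divff ?pnatr_eq0// of_real1 scale1r.
      rewrite (of_realD k 1 1) of_real1 scalerDl scale1r.
      by rewrite addrACA -opprD.
    rewrite rnormZ ger0_norm// mulrC ler_pM2l//; apply: dlb.
    exact/MZ/MD.
  have := rnorm_parallelogram (z - u n) (z - u m).
  rewrite (_ : z - u n - (z - u m) = u m - u n); last first.
    by rewrite opprB addrC addrA subrK.
  rewrite rdistC => H.
  rewrite -ler_sqr ?nnegrE ?rnorm_ge0 ?(ltW e0)//.
  have := rnorm_ge0 (z - u n); have := rnorm_ge0 (z - u m).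
  by nra.
have [l hl] := rnorm_complete ucauchy.
have approx (e : R) : 0 < e ->
    exists m, [/\ M m, rnorm (z - m - (z - l)) <= e & rnorm (z - m) <= d + e].
  move=> e0; have hN n := @invr_truncn_le R e n e0.
  set N := Num.truncn _ in hN.
  have [N' _ hN'] := (cvg_rnorm_lt _ _).1 hl _ e0.
  have [Mm hm] := hu (maxn N N'); exists (u (maxn N N')); split => //.
    have /= /ltW := hN' (maxn N N') (leq_maxr _ _).
    by rewrite opprB [z - _ + _]addrC addrA subrK.
  by apply: (le_trans (ltW hm)); rewrite lerD2l hN// leq_maxl.
exists (z - l); split; last first.
  by move=> e /approx[m [Mm h _]]; exists m.
move=> m Mm; apply: rinner_eq0_of_min => t.
apply/ler_addgt0Pr => e e0.
(* One third of e for each of three errors: m' as a near minimizer, and the replacement of z - l by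
   z - m' on either side of the inequality. *)
have [m' [Mm' h1 h2]] := approx _ (divr_gt0 e0 (ltr0Sn R 2)).
have h3 := dlb _ (MD _ _ Mm' (MZ t _ Mm)).
have h4 := ler_rnorm_add (z - l) (z - m').
have h5 := ler_rnorm_add (z - (m' + of_real k t *: m)) (z - l - of_real k t *: m).
rewrite [rnorm (z - l - _)]rdistC in h4.
have h6 : z - (m' + of_real k t *: m) - (z - l - of_real k t *: m) = z - m' - (z - l).
  have sub2 (a b : V) : z - a - (z - b) = b - a.
    by rewrite opprB [z - a + _]addrC addrA subrK.
  by rewrite -[z - l - _]addrA -opprD !sub2 opprD addrACA subrr addr0.
by rewrite h6 in h5; lra.
Qed.

(** Letting c range over all scalars recovers the full inner product from its real part; over R[i],
    c = i tests the imaginary part. *)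
Lemma inner_eq0 (x y : V) :
  (forall c : K, rinner x (c *: y) = 0) -> inner x y = 0.
Proof.
move=> h; rewrite innerC -[RHS](_ : scalar_conj 0 = 0); last first.
  by rewrite -(of_real0 R) scalar_conj_of_real.
congr scalar_conj; apply: scalar_eq0 => c.
by rewrite -linearZl_LR -(h c) rinnerC.
Qed.

(** The representing vector is a multiple of w, the component orthogonal to the kernel of f of a
    vector z0 with f z0 nonzero. *)
Lemma riesz (f : V -> K) (C : R) : scalar f ->
  (forall x, scalar_re `|f x| <= C * rnorm x) ->
  exists v, forall z, f z = inner z v.
Proof.
move=> flin fbd.
have f0 : f 0 = 0 by have := flin (-1) 0 0; rewrite scaler0 addr0 mulN1r addNr.
have fZ c x : f (c *: x) = c * f x by have := flin c x 0; rewrite !addr0 f0 addr0.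
have fD x y : f (x + y) = f x + f y by rewrite -{1}(scale1r x) flin mul1r.
have fN x : f (- x) = - f x by rewrite -scaleN1r fZ mulN1r.
have [h|/existsNP[z0 z0f]] := pselect (forall z, f z = 0).
  by exists 0 => z; rewrite h linear0r.
have [w [wM hw]] := @orthogonal_projection [set x | f x = 0] z0 f0
  (fun x y (hx : f x = 0) (hy : f y = 0) =>
     etrans (fD x y) (etrans (congr2 +%R hx hy) (addr0 0)))
  (fun a x (hx : f x = 0) => etrans (fZ _ x) (etrans (congr1 _ hx) (mulr0 _))).
(* z0 - w is a limit of elements of the kernel, and f is bounded. *)
have fwz : f w = f z0.
  apply/esym/eqP; rewrite -subr_eq0; apply/eqP/scalar_re_norm_le0.
  apply/ler_addgt0Pr => e e0; rewrite add0r.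
  have C1 : 0 < `|C| + 1 by rewrite ltr_wpDl.
  have [m /= Mm hm] := hw _ (divr_gt0 e0 C1).
  have -> : f z0 - f w = f (z0 - m - w) by rewrite !fD !fN Mm oppr0 addr0.
  apply: (le_trans (fbd _)); rewrite ler_pdivlMr// in hm.
  apply: le_trans hm; rewrite mulrC ler_wpM2l ?rnorm_ge0//.
  by rewrite (le_trans (ler_norm _))// lerDl.
have fw0 : f w != 0 by rewrite fwz; apply/eqP.
have w0 : inner w w != 0.
  rewrite inner_norm sqrf_eq0 normr_eq0; apply: contra fw0 => /eqP->.
  by rewrite f0.
(* The inner product is conjugate-linear in its second argument, whence the conjugate. The formula
   follows because z - (f z / f w) w is in the kernel, hence orthogonal to w. *)
exists (scalar_conj (f w / inner w w) *: w) => z.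
rewrite [inner z _]innerC linearZl_LR /=.
rewrite [X in _ = X]scalar_conjM  scalar_conjK -[scalar_conj (inner w z)]innerC.
have z'M : f (z - (f z / f w) *: w) = 0.
  by rewrite fD fN fZ divfK// subrr.
have : inner w (z - (f z / f w) *: w) = 0.
  apply: inner_eq0 => c; apply: wM.
  by rewrite /= fZ z'M mulr0.
move/(congr1 (@scalar_conj R k)); rewrite -innerC linearBl linearZl_LR /=.
rewrite -[X in scalar_conj X](of_real0 R) scalar_conj_of_real of_real0 => /eqP.
rewrite subr_eq0 => /eqP ->.
by rewrite mulrCA !divfK.
Qed.

End projection.

Section adjoint.
Context (R : realType) (k : scalar_kind).
Local Notation K := (Defs.scalar R k).

Lemma linear_continuous_rbounded (V W : hilbertType R k) (f : V -> W) :
  linear f -> continuous f ->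
  exists2 C : R, 0 < C & forall x, rnorm (f x) <= C * rnorm x.
Proof.
move=> flin fc.
pose g : {linear V -> W} := HB.pack f (GRing.isLinear.Build _ _ _ _ _ flin).
have /linear_bounded_continuous/linear_boundedP/pinfty_ex_gt0[r r0 hr] :
  continuous g by [].
have re0 := of_real_re (ltW r0).
exists (scalar_re r); first by rewrite -(ltr_of_real k) re0 of_real0.
by move=> x; rewrite -(ler_of_real k) of_realM re0 -!normE; exact: hr.
Qed.

(** Riesz applied to z |-> <f z, w> shows that the [xget] in [adjoint] selects a genuine
    representative instead of its default. *)
Lemma adjointE (V W : hilbertType R k) (f : V -> W) (w : W) (z : V) :
  linear f -> continuous f -> inner (f z) w = inner z (adjoint f w).
Proof.
move=> flin fc; have [C C0 fC] := linear_continuous_rbounded flin fc.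
suff [v hv] : exists v, forall z, inner (f z) w = inner z v.
  by rewrite /adjoint; case: xgetP => [v' _ -> //|/(_ v)].
apply: (@riesz _ _ _ _ (C * rnorm w)).
  by move=> a x y; rewrite flin linearDl linearZl_LR.
move=> x; apply: (le_trans (ler_inner _ _)).
by rewrite mulrAC ler_wpM2r ?rnorm_ge0.
Qed.

Lemma rinner_adjoint (V W : hilbertType R k) (f : V -> W) (w : W) (z : V) :
  linear f -> continuous f -> rinner (f z) w = rinner z (adjoint f w).
Proof. by move=> flin fc; rewrite /rinner adjointE. Qed.

Lemma rnorm_adjoint (V W : hilbertType R k) (f : V -> W) (w : W) (C : R) :
  linear f -> continuous f -> 0 <= C -> (forall x, rnorm (f x) <= C * rnorm x) ->
  rnorm (adjoint f w) <= C * rnorm w.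
Proof.
move=> flin fc C0 fC; set v := adjoint f w.
have [->|v0] := eqVneq (rnorm v) 0; first by rewrite mulr_ge0 ?rnorm_ge0.
have vp : 0 < rnorm v by rewrite lt0r v0 rnorm_ge0.
rewrite -(ler_pM2r vp) -expr2 -rinnerxx -rinner_adjoint//.
apply: (le_trans (ler_norm _)); apply: (le_trans (ler_rinner _ _)).
by rewrite mulrAC ler_wpM2r ?rnorm_ge0.
Qed.

End adjoint.

(** * Uniform boundedness and strongly continuous semigroups *)

Section uniform_boundedness.
Context (R : realType) (k : scalar_kind) (V W : hilbertType R k).
Context (I : Type) (F : I -> V -> W).
Context (Flin : forall i, linear (F i)) (Fcont : forall i, continuous (F i)).

Let FB i x y : F i (x - y) = F i x - F i y.
Proof. by rewrite [x - y]addrC -scaleN1r Flin scaleN1r addrC. Qed.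

Let F0 i : F i 0 = 0.
Proof. by rewrite -(subrr 0) FB subrr. Qed.

Let FZ i (a : R) x : F i (of_real k a *: x) = of_real k a *: F i x.
Proof. by have := Flin i (of_real k a) x 0; rewrite !addr0 F0 addr0. Qed.

Let bounded (M : R) := forall i x, rnorm (F i x) <= M * rnorm x.

(** A bound n on the ball of radius r around x would give the global bound 2 n / r: with y = x - (r
    / |v|) v in the ball, (r / |v|) F v = F x - F y. *)
Lemma unbounded_on_ball (x : V) (r n : R) : ~ (exists M, bounded M) -> 0 < r ->
  exists y, rnorm (x - y) <= r /\ exists i, n < rnorm (F i y).
Proof.
move=> unb r0; apply: contrapT => h; apply: unb.
have {}h y i : rnorm (x - y) <= r -> rnorm (F i y) <= n.
  by move=> xy; rewrite leNgt; apply/negP => ny; apply: h; exists y; split => //; exists i.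
exists (n *+ 2 / r) => i v.
have [v0|v0] := eqVneq (rnorm v) 0.
  have /eqP -> : v == 0 by rewrite -rnorm_eq0 v0 eqxx.
  by rewrite F0 !rnorm0 mulr0.
have vp : 0 < rnorm v by rewrite lt0r v0 rnorm_ge0.
have rv : 0 < r / rnorm v by rewrite divr_gt0.
have hx := h x i; rewrite subrr rnorm0 (ltW r0) in hx.
pose y := x - of_real k (r / rnorm v) *: v.
have hy : rnorm (F i y) <= n.
  by apply: h; rewrite opprB addrC subrK rnormZ gtr0_norm// divfK.
have := ler_rnormD (F i x) (- F i y).
rewrite -FB rnormN /y opprB addrC subrK FZ rnormZ gtr0_norm//.
move=> H; have {}H : r / rnorm v * rnorm (F i v) <= n *+ 2.
  by apply: (le_trans H); rewrite mulr2n lerD// hx.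
rewrite mulrAC ler_pdivlMr// mulrC.
by move: H; rewrite mulrAC ler_pdivrMr.
Qed.

(** Nested balls: if no common bound exists, balls can be shrunk so that on the ball of index n + 1
    some member of the family has norm at least n. A point common to all of them contradicts the
    pointwise bounds. *)
Lemma uniform_boundedness :
  (forall x, exists M, forall i, rnorm (F i x) <= M) ->
  exists2 M, 0 < M & bounded M.
Proof.
move=> ptw; have [[M hM]|unb] := pselect (exists M, bounded M).
  exists (`|M| + 1); first by rewrite ltr_wpDl.
  move=> i x; apply: (le_trans (hM i x)); rewrite ler_wpM2r ?rnorm_ge0//.
  by rewrite (le_trans (ler_norm _))// lerDl.
exfalso.
(* A state is a pair (centre, radius). The premise 0 < radius makes the step total, as [choice]
   requires; the recursion keeps it true. *)
pose P (ns : nat * (V * R)) (s' : V * R) := 0 < ns.2.2 ->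
  [/\ 0 < s'.2, s'.2 <= ns.1.+1%:R^-1, rnorm (ns.2.1 - s'.1) <= ns.2.2 - s'.2
    & exists i, forall v, rnorm (v - s'.1) <= s'.2 -> ns.1%:R <= rnorm (F i v)].
have /choice[step hstep] ns : exists s', P ns s'.
  case: ns => n [x r]; have [r0|r0] := ltP 0 r; last first.
    by exists (x, r); rewrite /P /= ltNge r0.
  have r20 : 0 < r / 2 by rewrite divr_gt0.
  have [y [xy [i hi]]] := unbounded_on_ball x (n%:R + 1) unb r20.
  have [C C0 hC] := linear_continuous_rbounded (@Flin i) (@Fcont i).
  (* r / 2 keeps the new ball inside the old one, 1 / (n + 1) forces the radii to 0, and 1 / C lets
     [F i] vary by at most 1, so that n + 1 at the centre leaves n on the ball. *)
  pose r' := Num.min (r / 2) (Num.min n.+1%:R^-1 C^-1).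
  have r'0 : 0 < r' by rewrite !lt_min r20 invr_gt0 ltr0n invr_gt0 C0.
  exists (y, r') => /= _; split => //.
  - by rewrite !ge_min lexx orbT.
  - apply: (le_trans xy); rewrite lerBrDr [leRHS](splitr r) lerD2l.
    by rewrite ge_min lexx.
  - exists i => v /= vy.
    have h1 : rnorm (F i (y - v)) <= 1.
      apply: (le_trans (hC _)); rewrite rdistC mulrC -ler_pdivlMr// mul1r.
      by apply: (le_trans vy); rewrite !ge_min lexx !orbT.
    by have := ler_rnorm_add (F i y) (F i v); rewrite -FB => ?; lra.
pose fix s n := if n is m.+1 then step (m, s m) else (0 : V, 1 : R).
have s0 n : 0 < (s n).2.
  by elim: n => [|n IH] /=; [exact: ltr01|case: (hstep (n, s n) IH)].
have sP n : [/\ (s n.+1).2 <= n.+1%:R^-1,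
    rnorm ((s n).1 - (s n.+1).1) <= (s n).2 - (s n.+1).2
    & exists i, forall v, rnorm (v - (s n.+1).1) <= (s n.+1).2 ->
        n%:R <= rnorm (F i v)].
  by have [] := hstep (n, s n) (s0 n).
have nested n m : (n <= m)%N -> rnorm ((s n).1 - (s m).1) <= (s n).2 - (s m).2.
  move=> /subnKC <-; elim: (m - n)%N => [|d IH].
    by rewrite addn0 !subrr rnorm0.
  rewrite addnS; have [_ h _] := sP (n + d)%N.
  have -> : (s n).1 - (s (n + d).+1).1
      = ((s n).1 - (s (n + d)%N).1) + ((s (n + d)%N).1 - (s (n + d).+1).1).
    by rewrite addrA subrK.
  apply: (le_trans (ler_rnormD _ _)).
  by apply: le_trans (lerD IH h) _; rewrite addrA subrK.
have nested' n m : (n <= m)%N -> rnorm ((s n).1 - (s m).1) <= (s n).2.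
  by move=> /nested/le_trans; apply; rewrite gerBl ltW.
have [l hl] : exists l : V, (s n).1 @[n --> \oo] --> l.
  apply: rnorm_complete => e e0; have e20 : 0 < e / 2 by rewrite divr_gt0.
  exists (Num.truncn (e / 2)^-1).+1 => n m hn hm.
  have hs : (s (Num.truncn (e / 2)^-1).+1).2 <= e / 2.
    have [h _ _] := sP (Num.truncn (e / 2)^-1).
    exact: le_trans h (invr_truncn_le e20 (leqnn _)).
  have h1 := nested' _ _ hn; have h2 := nested' _ _ hm.
  have := ler_rnormD (- ((s (Num.truncn (e / 2)^-1).+1).1 - (s n).1))
     ((s (Num.truncn (e / 2)^-1).+1).1 - (s m).1).
  by rewrite rnormN opprB addrA subrK => ?; lra.
have hl' n : rnorm (l - (s n).1) <= (s n).2.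
  apply/ler_addgt0Pr => e e0.
  have [N _ hN] := (cvg_rnorm_lt _ _).1 hl _ e0.
  have /= h1 := hN (maxn N n) (leq_maxl _ _).
  have h2 := nested' _ _ (leq_maxr N n).
  have := ler_rnormD (l - (s (maxn N n)).1) ((s (maxn N n)).1 - (s n).1).
  by rewrite addrA subrK; rewrite rdistC in h2 => ?; lra.
have [M hM] := ptw l.
have [_ _ [i hi]] := sP (Num.truncn M).+1.
have := le_trans (hi _ (hl' _)) (hM i).
by rewrite leNgt truncnS_gt.
Qed.

End uniform_boundedness.

Section semigroup.
Context (R : realType) (k : scalar_kind) (X : hilbertType R k).
Context (S : R -> X -> X) (hS : C0_semigroup S).

(** Otherwise there are times t n <= 1 / (n + 1) at which S violates the bound n + 1. The operators
    S (t n) are pointwise bounded, since S s x tends to x as s decreases to 0, so uniform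
    boundedness excludes this. *)
Lemma semigroup_bounded_near0 : exists d M : R, [/\ 0 < d, 0 < M &
  forall t x, 0 <= t -> t <= d -> rnorm (S t x) <= M * rnorm x].
Proof.
have [Slin S0 SD Sc] := hS; apply: contrapT => h.
have /choice[t ht] n : exists t, [/\ 0 <= t, t <= n.+1%:R^-1 &
    exists x, n.+1%:R * rnorm x < rnorm (S t x)].
  apply: contrapT => h'; apply: h; exists n.+1%:R^-1, n.+1%:R.
  split; rewrite ?invr_gt0// => t x t0 tn; rewrite leNgt; apply/negP => hx.
  by apply: h'; exists t; split => //; exists x.
have [||x|M M0 hM] := @uniform_boundedness _ _ _ _ nat (fun n => S (t n)).
- by move=> n; have [t0 _ _] := ht n; case: (Slin _ t0).
- by move=> n; have [t0 _ _] := ht n; case: (Slin _ t0).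
- have /(cvg_rnorm_lt _ _).1/(_ 1 ltr01)[d /= d0 hd] := Sc x.
  have hsmall (s : R) : 0 <= s -> s < d -> rnorm (S s x) <= rnorm x + 1.
    (* The filter at [0^'+] says nothing about s = 0, where S is the identity. *)
    rewrite le_eqVlt => /predU1P[<- _|s0 sd].
      by rewrite S0 lerDl.
    have := hd s; rewrite /= sub0r normrN gtr0_norm// => /(_ sd s0) h1.
    have := ler_rnorm_add (S s x) x; rewrite rdistC => ?; lra.
  pose N := Num.truncn d^-1.
  (* The sum covers the finitely many indices for which t i < d is not known; [rnorm x + 1] covers
     the others. *)
  exists (\sum_(i < N.+1) rnorm (S (t i) x) + (rnorm x + 1)) => i.
  have [iN|Ni] := ltnP i N.+1.
    rewrite (bigD1 (Ordinal iN))//= -addrA lerDl addr_ge0//.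
      by apply: sumr_ge0 => *; exact: rnorm_ge0.
    by rewrite addr_ge0 ?rnorm_ge0.
  have [ti0 ti _] := ht i.
  apply: (@le_trans _ _ (rnorm x + 1)).
    apply: hsmall => //; apply: (le_lt_trans ti).
    rewrite -[ltRHS]invrK ltf_pV2 ?posrE ?invr_gt0//.
    by apply: (lt_trans (truncnS_gt _)); rewrite ltr_nat ltnS.
  by rewrite lerDr; apply: sumr_ge0 => *; exact: rnorm_ge0.
have [_ _ [x hx]] := ht (Num.truncn M).
have := lt_le_trans hx (hM (Num.truncn M) x).
apply/negP; rewrite -leNgt ler_wpM2r ?rnorm_ge0//.
exact/ltW/truncnS_gt.
Qed.

(** The semigroup law peels off steps of length at most d, each costing a factor M. *)
Lemma semigroup_bounded (T : R) : exists2 M : R, 0 < M &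
  forall t x, 0 <= t -> t <= T -> rnorm (S t x) <= M * rnorm x.
Proof.
have [d [M [d0 M0 hM]]] := semigroup_bounded_near0.
have [Slin S0 SD Sc] := hS.
suff H N : forall t x, 0 <= t -> t <= d *+ N -> rnorm (S t x) <= M ^+ N * rnorm x.
  exists (M ^+ (Num.truncn (T / d)).+1); first exact: exprn_gt0.
  move=> t x t0 tT; apply: H => //; apply: (le_trans tT).
  by rewrite -mulr_natl -ler_pdivrMr// ltW// truncnS_gt.
elim: N => [|N IH] t x t0 tN.
  have -> : t = 0 by apply/le_anti; rewrite t0 andbT -(mulr0n d).
  by rewrite S0 expr0 mul1r.
pose s := Num.min t d.
have s0 : 0 <= s by rewrite le_min t0 ltW.
have st : s <= t by rewrite ge_min lexx.
have sd : s <= d by rewrite ge_min lexx orbT.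
have -> : S t x = S s (S (t - s) x).
  by rewrite -SD ?subr_ge0// addrC subrK.
apply: (le_trans (hM _ _ s0 sd)); rewrite exprS -mulrA ler_pM2l//.
apply: IH; first by rewrite subr_ge0.
rewrite /s; have [td|td] := leP t d; first by rewrite subrr mulrn_wge0// ltW.
by rewrite lerBlDl -mulrS.
Qed.

(** For s <= t, S t x - S s x = S s (S (t - s) x - x), so right continuity at 0 and the uniform
    bound M suffice. *)
Lemma semigroup_unif_continuous (T : R) (x : X) (e : R) : 0 < e ->
  exists2 d : R, 0 < d & forall t s, 0 <= t -> t <= T -> 0 <= s -> s <= T ->
    `|t - s| < d -> rnorm (S t x - S s x) <= e.
Proof.
move=> e0; have [M M0 hM] := semigroup_bounded T.
have [Slin S0 SD Sc] := hS.
have /(cvg_rnorm_lt _ _).1/(_ _ (divr_gt0 e0 M0))[d /= d0 hd] := Sc x.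
exists d => // t s.
wlog : t s / s <= t.
  move=> H t0 tT s0 sT; have [st|/ltW ts] := leP s t; first exact: H.
  by rewrite rdistC distrC; exact: H.
rewrite le_eqVlt => /predU1P[->|st] t0 tT s0 sT tsd.
  by rewrite subrr rnorm0 ltW.
have ts0 : 0 < t - s by rewrite subr_gt0.
have Sts : S t x = S s (S (t - s) x) by rewrite -SD ?(ltW ts0)// addrC subrK.
have [Sl _] := Slin _ s0.
have -> : S t x - S s x = S s (S (t - s) x - x).
  by rewrite Sts [S (t - s) x - x]addrC -(scaleN1r x) Sl scaleN1r addrC.
apply: (le_trans (hM _ _ s0 sT)); rewrite mulrC -ler_pdivlMr// rdistC.
by apply/ltW/hd => //=; rewrite sub0r normrN.
Qed.

End semigroup.

(** * Simple functions *)

Section simple_functions.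
Context (R : realType) (k : scalar_kind).
Implicit Types V W : hilbertType R k.

(** Only finitely many pairs of values occur, so any preimage is a finite union of intersections of
    level sets, whatever A is. *)
Lemma simple_bin_measurable V W (Z : Type) (s : {fimfun R >-> V})
    (s' : {fimfun R >-> W}) (h : V -> W -> Z) (A : set Z) :
  simple s -> simple s' -> measurable ((fun t => h (s t) (s' t)) @^-1` A).
Proof.
move=> ms ms'.
pose P := (range s `*` range s') `&` [set p | A (h p.1 p.2)].
rewrite (_ : _ @^-1` _ =
    \bigcup_(p in P) (s @^-1` [set p.1] `&` s' @^-1` [set p.2])).
  apply: fin_bigcup_measurable; last by move=> p _; apply: measurableI.
  by apply: finite_setIl; apply: finite_setX; exact: fimfunP.
apply/seteqP; split => [t At|t [[a b]] /= [_ Ah] [-> ->] //].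
by exists (s t, s' t) => //; split => //; split; exists t.
Qed.

Lemma simple_bin_finite V W (Z : Type) (s : {fimfun R >-> V})
    (s' : {fimfun R >-> W}) (h : V -> W -> Z) :
  finite_set (range (fun t => h (s t) (s' t))).
Proof.
apply: (@sub_finite_set _ _ ((fun p => h p.1 p.2) @` (range s `*` range s'))).
  by move=> _ [t _ <-]; exists (s t, s' t) => //; split; exists t.
by apply: finite_image; apply: finite_setX; exact: fimfunP.
Qed.

Lemma mk_simple V (f : R -> V) : finite_set (range f) ->
  (forall v, measurable (f @^-1` [set v])) ->
  exists2 s : {fimfun R >-> V}, simple s & s = f :> (R -> V).
Proof.
move=> ff mf; have fP : f \in @fimfun R V by rewrite inE.
by exists (fimfun_Sub fP) => // v; exact: mf.
Qed.

Lemma simple_bin V W (Z : hilbertType R k) (s : {fimfun R >-> V})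
    (s' : {fimfun R >-> W}) (h : V -> W -> Z) : simple s -> simple s' ->
  exists2 s'' : {fimfun R >-> Z}, simple s'' & forall t, s'' t = h (s t) (s' t).
Proof.
move=> ms ms'; have [|v|s'' ms'' e] := @mk_simple _ (fun t => h (s t) (s' t)).
- exact: simple_bin_finite.
- exact: simple_bin_measurable.
- by exists s'' => // t; rewrite e.
Qed.

End simple_functions.

(** * Real-valued integrals over [0, T] *)

Section real_integrals.
Context (R : realType) (T : R).
Local Notation mu := (@lebesgue_measure R).
Local Notation D := (`[0, T]%classic).

Lemma itv_measure_fin : (mu D < +oo)%E.
Proof.
by rewrite lebesgue_measure_itv /=; case: ifP => _; rewrite -?EFinB ltry.
Qed.

Lemma bounded_integrable (f : R -> R) (M : R) : measurable_fun D f ->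
  (forall t, D t -> `|f t| <= M) -> mu.-integrable D (EFin \o f).
Proof.
move=> mf fM; apply: measurable_bounded_integrable => //.
  exact: itv_measure_fin.
exists M; split; first exact: num_real.
by move=> x Mx t Dt /=; apply: (le_trans (fM _ Dt)); exact: ltW.
Qed.

Lemma EFin_integrableZl (c : R) (f : R -> R) : mu.-integrable D (EFin \o f) ->
  mu.-integrable D (EFin \o (fun t => c * f t)).
Proof.
move=> fi; rewrite (_ : _ \o _ = fun t => (c%:E * (EFin \o f) t)%E).
  by apply: integrableZl => //; exact: measurable_itv.
by apply/funext => t /=; rewrite EFinM.
Qed.

Lemma EFin_integrableB (f g : R -> R) : mu.-integrable D (EFin \o f) ->
  mu.-integrable D (EFin \o g) ->
  mu.-integrable D (EFin \o (fun t => f t - g t)).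
Proof.
move=> fi gi; rewrite (_ : _ \o _ = fun t => ((EFin \o f) t - (EFin \o g) t)%E).
  by apply: integrableB => //; exact: measurable_itv.
by apply/funext => t /=; rewrite EFinB.
Qed.

Lemma indic_integrable (E : set R) : measurable E ->
  mu.-integrable D (EFin \o \1_E).
Proof.
move=> mE; apply: (@bounded_integrable _ 1); first exact: measurable_indic.
by move=> t _; rewrite indicE; case: (_ \in _); rewrite ?normr1 ?normr0.
Qed.

Lemma Rintegral_sum (I : Type) (r : seq I) (F : I -> R -> R) :
  (forall i, mu.-integrable D (EFin \o F i)) ->
  \int[mu]_(t in D) (\sum_(i <- r) F i t) = \sum_(i <- r) \int[mu]_(t in D) F i t.
Proof.
move=> Fint; elim: r => [|i r IH].
  rewrite big_nil -[RHS](@mul0r _ (fine (mu D))) -Rintegral_cst//.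
  by apply: eq_Rintegral => t _; rewrite big_nil.
rewrite big_cons -IH -RintegralD//.
  by apply: eq_Rintegral => t _; rewrite big_cons.
rewrite (_ : _ \o _ = fun t => (\sum_(i <- r) (EFin \o F i) t)%E).
  exact: integrable_sum.
by apply/funext => t /=; rewrite sumEFin.
Qed.

(* The integral of a nonnegative function is the supremum of the integrals of
   the simple functions below it, hence monotone even without measurability. *)
Lemma ge0_le_lower_integral (f g : R -> \bar R) :
  (forall t, D t -> 0 <= f t)%E -> (forall t, D t -> f t <= g t)%E ->
  (\int[mu]_(t in D) f t <= \int[mu]_(t in D) g t)%E.
Proof.
move=> f0 fg.
have g0 t : D t -> (0 <= g t)%E by move=> Dt; exact: le_trans (f0 _ Dt) (fg _ Dt).
rewrite !ge0_integralE//; apply: le_ereal_sup => _ [h /= hf <-].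
exists h => // t; apply: (le_trans (hf t)).
by rewrite /patch; case: ifPn => //; rewrite inE => /fg.
Qed.

End real_integrals.

(** * Strong measurability and pairings with simple functions *)

Section bochner.
Context (R : realType) (k : scalar_kind) (T : R).
Implicit Types V W : hilbertType R k.
Local Notation mu := (@lebesgue_measure R).
Local Notation D := (`[0, T]%classic).

Lemma simple_strongly_measurable V (s : {fimfun R >-> V}) :
  simple s -> strongly_measurable T s.
Proof. by move=> ms; exists (fun=> s); split => // t _; exact: cvg_cst. Qed.

(** Sequential continuity of h makes the function a pointwise limit of measurable ones. Norms,
    distances and pairings are all instances. *)
Lemma strongly_measurable_bin V W (f : R -> V) (g : R -> W) (h : V -> W -> R) :
  strongly_measurable T f -> strongly_measurable T g ->
  (forall (u : nat -> V) (v : nat -> W) a b, u @ \oo --> a -> v @ \oo --> b ->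
     h (u n) (v n) @[n --> \oo] --> h a b) ->
  measurable_fun D (fun t => h (f t) (g t)).
Proof.
move=> [s [ms sf]] [s' [ms' sg]] hc.
apply: (@measurable_fun_cvg _ _ _ _ (fun n t => h (s n t) (s' n t))).
  move=> n _ B mB; apply: measurableI => //.
  exact: simple_bin_measurable.
by move=> t Dt; apply: hc; [exact: sf|exact: sg].
Qed.

Lemma simple_bounded V (s : {fimfun R >-> V}) :
  exists2 M, 0 <= M & forall t, rnorm (s t) <= M.
Proof.
have /finite_seqP[r hr] := fimfunP s.
exists (\sum_(v <- r) rnorm v); first by apply: sumr_ge0 => *; exact: rnorm_ge0.
move=> t; have str : s t \in r.
  have : range s (s t) by exists t.
  by rewrite hr.
rewrite (big_rem _ str)/= lerDl; apply: sumr_ge0 => *; exact: rnorm_ge0.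
Qed.

Lemma simple_rinner_integrable V (s : {fimfun R >-> V}) psi : simple s ->
  mu.-integrable D (EFin \o (fun t => rinner psi (s t))).
Proof.
move=> ms; have [M M0 hM] := simple_bounded s.
apply: (@bounded_integrable _ _ _ (rnorm psi * M)).
  move=> _ B mB; apply: measurableI => //.
  exact: (simple_bin_measurable (fun a _ => rinner psi a) _ ms ms).
move=> t _; apply: (le_trans (ler_rinner _ _)).
by rewrite ler_wpM2l ?rnorm_ge0.
Qed.

(** The function t |-> <psi, s t> is the sum of <psi, v> times the indicator of s = v over the
    finitely many values v. *)
Lemma rinner_simple_integral V (s : {fimfun R >-> V}) psi : simple s ->
  \int[mu]_(t in D) rinner psi (s t) = rinner psi (simple_integral T s).
Proof.
move=> ms; rewrite /simple_integral fsbig_finite//= rinnerC rinner_suml.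
set r := finmap.enum_fset (fset_set (range s)).
pose F v t : R := rinner psi v * \1_(s @^-1` [set v]) t.
have Iind v : mu.-integrable D (EFin \o \1_(s @^-1` [set v])).
  by apply: indic_integrable; exact: ms.
have Fint v : mu.-integrable D (EFin \o F v) by exact: EFin_integrableZl.
transitivity (\int[mu]_(t in D) \sum_(v <- r) F v t).
  apply: eq_Rintegral => t _; have st : s t \in range s by rewrite inE; exists t.
  have str : s t \in r := etrans (in_fset_set (fimfunP s) (s t)) st.
  rewrite (bigD1_seq (s t))//=; last exact: finmap.fset_uniq.
  rewrite big1 => [|v vst].
    by rewrite /F indicE mem_set//= mulr1 addr0.
  rewrite /F indicE memNset ?mulr0//= => h.
  by rewrite h eqxx in vst.
rewrite Rintegral_sum//; apply: eq_bigr => v _.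
rewrite rinnerZl rinnerC RintegralZl// mulrC; congr (_ * _).
rewrite /Rintegral integral_indic; first by rewrite setIC.
  exact: measurable_itv.
exact: ms.
Qed.

End bochner.

(** * The Bochner integral *)

Section bochner_theory.
Context (R : realType) (k : scalar_kind) (T : R).
Implicit Types V W : hilbertType R k.
Local Notation mu := (@lebesgue_measure R).
Local Notation D := (`[0, T]%classic).

Lemma ge0_cvge0P (a : nat -> \bar R) : (forall n, 0 <= a n)%E ->
  a @ \oo --> 0%E <-> forall e : R, 0 < e -> \forall n \near \oo, (a n <= e%:E)%E.
Proof.
move=> a0; split=> [/fine_cvgP[afin /cvgrPdist_lt ac] e e0|h].
  have := ac _ e0; apply: filterS2 afin => n an.
  rewrite sub0r normrN ger0_norm ?fine_ge0// => /ltW.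
  by rewrite -lee_fin fineK.
apply/fine_cvgP; split.
  have := h 1 ltr01; apply: filterS => n an.
  by rewrite ge0_fin_numE// (le_lt_trans an)// ltry.
apply/cvgrPdist_le => e e0; have := h _ e0; apply: filterS => n an.
rewrite sub0r normrN ger0_norm ?fine_ge0// -lee_fin fineK//.
by rewrite ge0_fin_numE// (le_lt_trans an)// ltry.
Qed.

Lemma cvg_rinner V (psi l : V) (u : nat -> V) : u @ \oo --> l ->
  rinner psi (u n) @[n --> \oo] --> rinner psi l.
Proof.
move=> ul; apply/cvgrPdist_le => e e0.
have p0 : 0 < rnorm psi + 1 by rewrite ltr_wpDl ?rnorm_ge0.
have /cvg_rnorm_lt/(_ _ (divr_gt0 e0 p0)) := ul.
apply: filterS => n hn; rewrite -rinnerNr -rinnerDr.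
apply: (le_trans (ler_rinner _ _)).
rewrite ltr_pdivlMr// in hn; apply: le_trans (ltW hn).
by rewrite mulrC ler_wpM2l ?rnorm_ge0// lerDl.
Qed.

Lemma ler_rdist V (x y : V) : `|rnorm x - rnorm y| <= rnorm (x - y).
Proof.
rewrite ler_norml lerNl opprB !lerBlDl ler_rnorm_add andbT.
by rewrite rdistC ler_rnorm_add.
Qed.

Lemma cvg_rnorm_sub V (u v : nat -> V) a b : u @ \oo --> a -> v @ \oo --> b ->
  rnorm (u n - v n) @[n --> \oo] --> rnorm (a - b).
Proof.
move=> ua vb; apply/cvgrPdist_le => e e0.
have /cvg_rnorm_lt/(_ _ e0) : u n - v n @[n --> \oo] --> a - b by exact: cvgB.
by apply: filterS => n /ltW/(le_trans (ler_rdist _ _)).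
Qed.

Lemma measurable_rnorm_sub V (f g : R -> V) :
  strongly_measurable T f -> strongly_measurable T g ->
  measurable_fun D (fun t => rnorm (f t - g t)).
Proof.
move=> mf mg; apply: (strongly_measurable_bin (h := fun a b => rnorm (a - b)) mf mg).
by move=> u v a b; exact: cvg_rnorm_sub.
Qed.

Lemma measurable_rinner V (f : R -> V) psi : strongly_measurable T f ->
  measurable_fun D (fun t => rinner psi (f t)).
Proof.
move=> mf; apply: (strongly_measurable_bin (h := fun a b => rinner psi a) mf mf).
by move=> u v a b ua _; exact: cvg_rinner.
Qed.

Lemma measurable_rnorm V (f : R -> V) : strongly_measurable T f ->
  measurable_fun D (fun t => rnorm (f t)).
Proof.
move=> mf; apply: (strongly_measurable_bin (h := fun a b => rnorm a) mf mf).
move=> u v a b /cvg_rnorm_lt ua _; apply/cvgrPdist_le => e /ua.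
by apply: filterS => n /ltW/(le_trans (ler_rdist _ _)).
Qed.

Lemma L1dist_integrable V (f g : R -> V) :
  strongly_measurable T f -> strongly_measurable T g ->
  (\int[mu]_(t in D) (rnorm (f t - g t))%:E < +oo)%E ->
  mu.-integrable D (EFin \o (fun t => rnorm (f t - g t))).
Proof.
move=> mf mg fin; apply/integrableP; split.
  by apply/measurable_EFinP; exact: measurable_rnorm_sub mf mg.
apply: le_lt_trans fin; apply: ge0_le_lower_integral => [t _|t _] /=.
  by rewrite lee_fin normr_ge0.
by rewrite lee_fin ger0_norm ?rnorm_ge0.
Qed.

(** The identity for simple functions passes to the limit: the left side moves by at most |psi|
    times the L1 distance from f to [s n], the right side by <psi, [simple_integral T (s n)] -
    v>. *)
Lemma bochner_weak V (f : R -> V) v psi : is_bochner_integral T f v ->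
  mu.-integrable D (EFin \o (fun t => rinner psi (f t))) /\
  \int[mu]_(t in D) rinner psi (f t) = rinner psi v.
Proof.
move=> [mf [s [ms fs sv]]].
have mss n : strongly_measurable T (s n) := simple_strongly_measurable T (ms n).
have p0 : 0 < rnorm psi + 1 by rewrite ltr_wpDl ?rnorm_ge0.
have fs' : forall e : R, 0 < e -> \forall n \near \oo,
    (\int[mu]_(t in D) (rnorm (f t - s n t))%:E <= e%:E)%E.
  move=> e e0; move: e e0; apply/ge0_cvge0P => // n.
  by apply: integral_ge0 => t _; rewrite lee_fin rnorm_ge0.
(* The first few distances may be infinite, so integrability is asserted only for those n whose
   distance has a finite bound. *)
have eint n e : (\int[mu]_(t in D) (rnorm (f t - s n t))%:E <= e%:E)%E ->
    mu.-integrable D (EFin \o (fun t => rnorm (psi) * rnorm (f t - s n t))).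
  move=> he; have h : mu.-integrable D (EFin \o (fun t => rnorm (f t - s n t))).
    by apply: L1dist_integrable => //; apply: (le_lt_trans he); rewrite ltry.
  exact: EFin_integrableZl.
have dint n e : (\int[mu]_(t in D) (rnorm (f t - s n t))%:E <= e%:E)%E ->
    mu.-integrable D (EFin \o (fun t => rinner psi (f t) - rinner psi (s n t))).
  move=> /eint; apply: le_integrable; first exact: measurable_itv.
    apply/measurable_EFinP/measurable_funB; exact: measurable_rinner.
  move=> t _ /=; rewrite lee_fin -rinnerNr -rinnerDr.
  by apply: (le_trans (ler_rinner _ _)); rewrite ler_norm.
have fint : mu.-integrable D (EFin \o (fun t => rinner psi (f t))).
  have [N _ hN] := fs' 1 ltr01; have h := hN N (leqnn N).
  rewrite (_ : EFin \o _ =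
    fun t => ((EFin \o (fun t => rinner psi (f t) - rinner psi (s N t))%R) t
      + (EFin \o (fun t => rinner psi (s N t))) t)%E); last first.
    by apply/funext => t /=; rewrite -EFinD subrK.
  apply: integrableD; first exact: measurable_itv.
    exact: dint h.
  exact: simple_rinner_integrable.
split=> //.
apply/eqP; rewrite -subr_eq0 -normr_le0; apply/ler_addgt0Pr => e e0.
rewrite add0r; have e20 : 0 < e / 2 by rewrite divr_gt0.
have /cvgrPdist_le/(_ _ e20)[N1 _ h1] := @cvg_rinner _ psi _ _ sv.
have [N2 _ h2] := fs' _ (divr_gt0 e20 p0).
have /= {}h1 := h1 (maxn N1 N2) (leq_maxl _ _).
have /= {}h2 := h2 (maxn N1 N2) (leq_maxr _ _).
set n := maxn N1 N2 in h1 h2.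
have h3 : `|\int[mu]_(t in D) rinner psi (f t) - rinner psi (simple_integral T (s n))| <= e / 2.
  rewrite -rinner_simple_integral// -RintegralB//; last first.
    exact: simple_rinner_integrable.
  have i1 := dint _ _ h2.
  apply: le_trans; first by apply: (le_normr_Rintegral _ i1); exact: measurable_itv.
  apply: (@le_trans _ _ (\int[mu]_(t in D) (rnorm psi * rnorm (f t - s n t)))).
    apply: le_Rintegral => //.
    - exact: (integrable_norm i1).
    - exact: (eint _ _ h2).
    - by move=> t _; rewrite -rinnerNr -rinnerDr ler_rinner.
  rewrite RintegralZl//; last first.
    by apply: L1dist_integrable => //; apply: (le_lt_trans h2); rewrite ltry.
  have h4 : \int[mu]_(t in D) rnorm (f t - s n t) <= e / 2 / (rnorm psi + 1).
    rewrite -lee_fin fineK//; rewrite ge0_fin_numE.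
      by apply: (le_lt_trans h2); rewrite ltry.
    by apply: integral_ge0 => t _; rewrite lee_fin rnorm_ge0.
  rewrite ler_pdivlMr// in h4; apply: le_trans h4; rewrite mulrC.
  rewrite ler_wpM2l ?lerDl//.
  by apply: Rintegral_ge0 => t _; exact: rnorm_ge0.
rewrite [leRHS](splitr e); apply: le_trans (lerD h3 h1).
rewrite [X in _ <= _ + X]distrC.
have := ler_normD (\int[mu]_(t in D) rinner psi (f t) - rinner psi (simple_integral T (s n)))
  (rinner psi (simple_integral T (s n)) - rinner psi v).
by rewrite addrA subrK.
Qed.

Lemma bochner_unique V (f : R -> V) v w :
  is_bochner_integral T f v -> is_bochner_integral T f w -> v = w.
Proof.
move=> fv fw; apply: rinner_inj => psi.
by rewrite -(bochner_weak psi fv).2 (bochner_weak psi fw).2.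
Qed.

Lemma bochner_integralE V (f : R -> V) v :
  is_bochner_integral T f v -> bochner_integral T f = v.
Proof.
move=> fv; rewrite /bochner_integral; case: xgetP => [w _ fw|/(_ v)//].
exact: bochner_unique fw fv.
Qed.

Lemma bochner_ext V (f g : R -> V) v : (forall t, 0 <= t -> t <= T -> f t = g t) ->
  is_bochner_integral T f v -> is_bochner_integral T g v.
Proof.
move=> fg [[s [ms sf]] [s' [ms' fs' sv]]]; split.
  exists s; split => // t Dt; rewrite -fg; first exact: sf.
    by move: Dt; rewrite in_itv => /andP[].
  by move: Dt; rewrite in_itv => /andP[].
exists s'; split => //; rewrite (_ : (fun n => _) =
  (fun n => \int[mu]_(t in D) (rnorm (f t - s' n t))%:E)%E)//.
apply/funext => n; apply: eq_integral => t.
by rewrite inE /= in_itv /= => /andP[t0 tT]; rewrite fg.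
Qed.

(** Testing against psi turns this into linearity of the real integral and avoids a common
    refinement of the level sets. *)
Lemma simple_integral_lin V (s s' s'' : {fimfun R >-> V}) (c : R) :
  simple s -> simple s' -> simple s'' ->
  (forall t, s'' t = of_real k c *: s t + s' t) ->
  simple_integral T s'' = of_real k c *: simple_integral T s + simple_integral T s'.
Proof.
move=> ms ms' ms'' h; apply: rinner_inj => psi.
rewrite rinnerDr rinnerZr -!rinner_simple_integral//.
have si := simple_rinner_integrable T psi ms.
rewrite -RintegralZl//.
rewrite -RintegralD//; last exact: simple_rinner_integrable.
  by apply: eq_Rintegral => t _; rewrite h rinnerDr rinnerZr.
exact: EFin_integrableZl.
Qed.

Lemma bochner_lin V (f g : R -> V) v w (c : R) :
  is_bochner_integral T f v -> is_bochner_integral T g w ->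
  is_bochner_integral T (fun t => of_real k c *: f t + g t) (of_real k c *: v + w).
Proof.
have slin (s s' : nat -> {fimfun R >-> V}) :
    (forall n, simple (s n)) -> (forall n, simple (s' n)) ->
    exists s'' : nat -> {fimfun R >-> V}, forall n, simple (s'' n) /\
      forall t, s'' n t = of_real k c *: s n t + s' n t.
  move=> ms ms'.
  have /choice[s'' hs''] : forall n, exists q : {fimfun R >-> V}, simple q /\
      forall t, q t = of_real k c *: s n t + s' n t.
    move=> n; have [q mq e] :=
      simple_bin (fun a b => of_real k c *: a + b) (ms n) (ms' n).
    by exists q.
  by exists s''.
move=> [[s0 [ms0 sf0]] [s [ms fs sv]]] [[s0' [ms0' sg0]] [s' [ms' gs' sw]]].
have smf : strongly_measurable T f by exists s0.
have smg : strongly_measurable T g by exists s0'.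
split.
  have [s'' hs''] := slin _ _ ms0 ms0'; exists s''; split=> [n|t Dt].
    by case: (hs'' n).
  rewrite (_ : (fun n => s'' n t) = (fun n => of_real k c *: s0 n t + s0' n t)).
    by apply: cvgD; [apply: cvgZr; exact: sf0|exact: sg0].
  by apply/funext => n; case: (hs'' n).
have [s'' hs''] := slin _ _ ms ms'; exists s''; split.
- by move=> n; case: (hs'' n).
- have p (h : R -> V) (q : nat -> {fimfun R >-> V}) n :
      (0 <= \int[mu]_(t in D) (rnorm (h t - q n t))%:E)%E.
    by apply: integral_ge0 => t _; rewrite lee_fin rnorm_ge0.
  apply/(ge0_cvge0P (p (fun t => of_real k c *: f t + g t) s'')) => e e0.
  have c0 : 0 < `|c| + 1 by rewrite ltr_wpDl.
  have e20 : 0 < e / 2 by rewrite divr_gt0.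
  have h1 := (ge0_cvge0P (p f s)).1 fs _ (divr_gt0 e20 c0).
  have := (ge0_cvge0P (p g s')).1 gs' _ e20.
  apply: filterS2 h1 => n h1 h2; have [_ e''] := hs'' n.
  have m1 := measurable_rnorm_sub smf (simple_strongly_measurable T (ms n)).
  have m2 := measurable_rnorm_sub smg (simple_strongly_measurable T (ms' n)).
  apply: (@le_trans _ _ (\int[mu]_(t in D)
      (`|c|%R%:E * (rnorm (f t - s n t)%R)%:E + (rnorm (g t - s' n t)%R)%:E))%E).
    apply: ge0_le_lower_integral => t _; first by rewrite lee_fin rnorm_ge0.
    rewrite e'' -EFinM -EFinD lee_fin -rnormZ.
    rewrite opprD addrACA -scalerBr; exact: ler_rnormD.
  rewrite ge0_integralD//; last 4 first.
  - by move=> t _; rewrite -EFinM lee_fin mulr_ge0 ?rnorm_ge0.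
  - by apply: measurable_funeM; exact/measurable_EFinP.
  - by move=> t _; rewrite lee_fin rnorm_ge0.
  - exact/measurable_EFinP.
  rewrite ge0_integralZl//; last 2 first.
  - exact/measurable_EFinP.
  - by move=> t _; rewrite lee_fin rnorm_ge0.
  rewrite (splitr e) EFinD; apply: leeD => //.
  apply: (@le_trans _ _ (`|c|%R%:E * (e / 2 / (`|c| + 1))%R%:E)%E).
    by apply: lee_wpmul2l => //; rewrite lee_fin.
  rewrite -EFinM lee_fin mulrA ler_pdivrMr// mulrC ler_wpM2l ?(ltW e20)//.
  by rewrite lerDl.
- rewrite (_ : (fun n => _) =
    (fun n => of_real k c *: simple_integral T (s n) + simple_integral T (s' n))).
    by apply: cvgD => //; apply: cvgZr.
  by apply/funext => n; case: (hs'' n) => m'' e''; exact: simple_integral_lin.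
Qed.

End bochner_theory.

(** * Existence of Bochner integrals *)

Section bochner_existence.
Context (R : realType) (k : scalar_kind) (T : R) (V : hilbertType R k).
Local Notation mu := (@lebesgue_measure R).
Local Notation D := (`[0, T]%classic).

(** On an interval of finite measure, uniform approximation by simple functions controls the L1
    distance and makes the simple integrals Cauchy. *)
Lemma bochner_exists (f : R -> V) :
  (forall e : R, 0 < e -> exists2 s : {fimfun R >-> V}, simple s &
     forall t, 0 <= t -> t <= T -> rnorm (f t - s t) <= e) ->
  exists v, is_bochner_integral T f v.
Proof.
move=> h; pose L := fine (mu D).
have L0 : 0 <= L by rewrite fine_ge0.
have muD : mu D = L%:E by rewrite fineK// ge0_fin_numE// itv_measure_fin.
(* L may be 0; L + 1 is a safe divisor. *)
have L1 : 0 < L + 1 by rewrite ltr_wpDl.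
have /choice[s hs] n : exists s : {fimfun R >-> V}, simple s /\
    forall t, D t -> rnorm (f t - s t) <= n.+1%:R^-1.
  have [|s ms e] := h n.+1%:R^-1; first by rewrite invr_gt0 ltr0n.
  by exists s; split => // t; rewrite /= in_itv /= => /andP[t0 tT]; exact: e.
have ms n : simple (s n) by case: (hs n).
have fs n t : D t -> rnorm (f t - s n t) <= n.+1%:R^-1 by case: (hs n) => _; exact.
have small (e : R) : 0 < e -> exists N, forall n, (N <= n)%N -> n.+1%:R^-1 <= e.
  by move=> e0; exists (Num.truncn e^-1) => n; exact: invr_truncn_le.
have sdist n m : rnorm (simple_integral T (s n) - simple_integral T (s m))
    <= (n.+1%:R^-1 + m.+1%:R^-1) * L.
  set x := simple_integral T (s n) - simple_integral T (s m).
  have [->|x0] := eqVneq (rnorm x) 0.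
    by rewrite mulr_ge0// addr_ge0// invr_ge0.
  have xp : 0 < rnorm x by rewrite lt0r x0 rnorm_ge0.
  (* Pairing the difference x with itself expresses |x|^2 as a real integral, whose integrand is
     bounded pointwise by Cauchy-Schwarz. *)
  rewrite -(ler_pM2l xp) -expr2 -rinnerxx {2}/x rinnerDr rinnerNr.
  rewrite -!rinner_simple_integral// -RintegralB//; last 2 first.
    exact: simple_rinner_integrable.
    exact: simple_rinner_integrable.
  rewrite mulrA -Rintegral_cst//; apply: le_Rintegral => //.
  - by apply: EFin_integrableB; exact: simple_rinner_integrable.
  - by apply: (@bounded_integrable _ _ _ `|rnorm x * (n.+1%:R^-1 + m.+1%:R^-1)|).
  - move=> t Dt; rewrite -rinnerNr -rinnerDr.
    apply: (le_trans (ler_norm _)); apply: (le_trans (ler_rinner _ _)).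
    rewrite ler_pM2l//.
    rewrite (_ : s n t - s m t = - (f t - s n t) + (f t - s m t)); last first.
      by rewrite opprB addrA subrK.
    apply: (le_trans (ler_rnormD _ _)); rewrite rnormN.
    by apply: lerD; exact: fs.
have [v hv] : exists v : V, simple_integral T (s n) @[n --> \oo] --> v.
  apply: rnorm_complete => e e0.
  have [N hN] := small _ (divr_gt0 (divr_gt0 e0 (ltr0Sn R 1)) L1).
  exists N => n m Nn Nm; apply: (le_trans (sdist n m)).
  have hn := hN _ Nn; have hm := hN _ Nm.
  rewrite ler_pdivlMr// in hn; rewrite ler_pdivlMr// in hm.
  have := invr_ge0 (n.+1%:R : R); have := invr_ge0 (m.+1%:R : R).
  rewrite !ler0n => i1 i2.
  rewrite mulrDl (splitr e); apply: lerD.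
    by apply: le_trans hn; rewrite ler_wpM2l ?i2// lerDl.
  by apply: le_trans hm; rewrite ler_wpM2l ?i1// lerDl.
exists v; split.
  exists s; split => // t Dt; apply/cvg_rnorm_lt => e e0.
  have [N hN] := small _ (divr_gt0 e0 (ltr0Sn R 1)); exists N => // n /= Nn.
  apply: (le_lt_trans (fs n t Dt)); apply: (le_lt_trans (hN _ Nn)).
  by rewrite ltr_pdivrMr// ltr_pMr// ltr1n.
exists s; split => //; apply/ge0_cvge0P.
  by move=> n; apply: integral_ge0 => t _; rewrite lee_fin rnorm_ge0.
move=> e e0; have [N hN] := small _ (divr_gt0 e0 L1); exists N => // n /= Nn.
apply: (@le_trans _ _ (\int[mu]_(t in D) (n.+1%:R^-1)%:E)%E).
  apply: ge0_le_lower_integral => t Dt; first by rewrite lee_fin rnorm_ge0.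
  by rewrite lee_fin fs.
rewrite integral_cst//= [X in (_ * X)%E](_ : _ = L%:E)// -EFinM lee_fin.
have := hN _ Nn; rewrite ler_pdivlMr//; apply: le_trans.
by rewrite ler_wpM2l ?lerDl ?invr_ge0.
Qed.

Lemma if_preimage (E : set R) (f g : R -> V) (A : set V) :
  (fun t => if t \in E then f t else g t) @^-1` A =
  (E `&` f @^-1` A) `|` (~` E `&` g @^-1` A).
Proof.
apply/seteqP; split => t /=.
  by case: ifPn; rewrite ?inE ?notin_setE => Et At; [left|right].
by move=> [[Et At]|[Et At]]; [rewrite mem_set|rewrite memNset].
Qed.

Lemma cst_preimage_measurable (w : V) (A : set V) :
  measurable ((fun=> w) @^-1` A : set R).
Proof.
have [Aw|Aw] := pselect (A w).
  by rewrite (_ : _ @^-1` _ = setT)//; apply/seteqP; split.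
by rewrite (_ : _ @^-1` _ = set0)//; apply/seteqP; split.
Qed.

Lemma simple_indicator (E : set R) (w : V) : measurable E ->
  exists2 s : {fimfun R >-> V}, simple s & forall t, s t = if t \in E then w else 0.
Proof.
move=> mE; have [||s ms e] := @mk_simple _ _ _ (fun t => if t \in E then w else 0).
- apply: (@sub_finite_set _ _ ([set w] `|` [set 0])).
    by move=> _ [t _ <-]; case: ifP => _; [left|right].
  by rewrite finite_setU; split; exact: finite_set1.
- move=> v; rewrite if_preimage; apply: measurableU; apply: measurableI => //.
  + exact: cst_preimage_measurable.
  + exact: measurableC.
  + exact: cst_preimage_measurable.
- by exists s => // t; rewrite e.
Qed.

(** g is sampled on a grid of mesh 1 / c < d, which gives step functions uniformly close to it. *)
Lemma bochner_exists_restrict (a b : R) (g : R -> V) : 0 <= a -> b <= T ->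
  (forall e : R, 0 < e -> exists2 d : R, 0 < d &
     forall t s, 0 <= t -> t <= T -> 0 <= s -> s <= T -> `|t - s| < d ->
       rnorm (g t - g s) <= e) ->
  exists v, is_bochner_integral T (fun t => if t \in `[a, b]%classic then g t else 0) v.
Proof.
move=> a0 bT gu; apply: bochner_exists => e e0.
have [d d0 hd] := gu _ e0.
pose c : R := (Num.truncn d^-1).+1%:R.
have c0 : 0 < c by rewrite ltr0n.
have cd : c^-1 < d by rewrite -[ltRHS]invrK ltf_pV2 ?posrE ?invr_gt0// truncnS_gt.
(* Rounding down keeps q t in [0, T] but may leave [a, b]: the cutoff is tested at t, and the
   modulus of continuity is used on all of [0, T]. *)
pose q t : R := (Num.truncn (c * t))%:R / c.
have [||s ms se] := @mk_simple _ _ _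
   (fun t => if t \in `[a, b]%classic then g (q t) else 0).
- apply: (@sub_finite_set _ _ ([set 0] `|`
    (fun i : nat => g (i%:R / c)) @` `I_(Num.truncn (c * b)).+1)).
    move=> _ [t _ <-]; case: ifPn; rewrite ?inE /= ?in_itv /= => tab; last by left.
    right; exists (Num.truncn (c * t)) => //=; rewrite ltnS le_truncn//.
    by rewrite ler_pM2l//; case/andP: tab.
  by rewrite finite_setU; split; [exact: finite_set1|exact: finite_image].
- move=> v; rewrite if_preimage; apply: measurableU; last first.
    apply: measurableI; last exact: cst_preimage_measurable.
    by apply: measurableC; exact: measurable_itv.
  (* Inside [a, b] a level set is the union of the grid cells whose left endpoint is sent to v. *)
  rewrite (_ : _ `&` _ = \bigcup_(i in [set i : nat | g (i%:R / c) = v])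
      (`[a, b]%classic `&` `[i%:R / c, i.+1%:R / c[%classic)).
    by apply: bigcup_measurable => i _; apply: measurableI; exact: measurable_itv.
  apply/seteqP; split => [t [/= tab gv]|t [i /= gv [tab ti]]].
    exists (Num.truncn (c * t)) => //; split => //=.
    rewrite in_itv /= ler_pdivrMr// ltr_pdivlMr// (mulrC t).
    apply: truncn_itv; rewrite mulr_ge0 ?(ltW c0)//.
    by move: tab; rewrite in_itv /= => /andP[at_ _]; exact: le_trans a0 at_.
  split => //; rewrite /= /q -gv; congr (g (_%:R / c)); apply/eqP.
  rewrite truncn_eq; last first.
    rewrite mulr_ge0 ?(ltW c0)//.
    by move: tab; rewrite in_itv /= => /andP[at_ _]; exact: le_trans a0 at_.
  by move: ti; rewrite in_itv /= ler_pdivrMr// ltr_pdivlMr// (mulrC t).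
exists s => // t t0 tT; rewrite se; case: ifP => _; last by rewrite subrr rnorm0 ltW.
have ct0 : 0 <= c * t by rewrite mulr_ge0 ?(ltW c0).
have /andP[h1 h2] := truncn_itv ct0.
have qt : q t <= t by rewrite /q ler_pdivrMr// (mulrC t).
have tq : t < q t + c^-1.
  by rewrite /q -[X in _ + X]mul1r -mulrDl ltr_pdivlMr// (mulrC t) natr1.
apply: hd => //.
- by rewrite /q divr_ge0 ?ler0n// ltW.
- exact: le_trans tT.
- rewrite ger0_norm ?subr_ge0// ltrBlDl; apply: (lt_trans tq).
  by rewrite ltrD2l.
Qed.

End bochner_existence.

(** * Controls and observations *)

(** Provides an interval of positive length inside [0, T] around t, also when t is an endpoint. *)
Lemma clipped_interval_lt (R : realFieldType) (T t d : R) :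
  0 < T -> 0 <= t -> t <= T -> 0 < d ->
  Num.max 0 (t - d / 2) < Num.min T (t + d / 2).
Proof.
move=> T0 t0 tT d0; rewrite lt_min !gt_max T0 /=.
by apply/and3P; split; lra.
Qed.

Section control.
Context (R : realType) (k : scalar_kind) (X U : hilbertType R k).
Context (S : R -> X -> X) (hS : C0_semigroup S).
Context (B : {linear U -> X}) (hB : continuous B) (T : R) (hT : 0 < T).
Local Notation mu := (@lebesgue_measure R).
Local Notation D := (`[0, T]%classic).

Lemma linearB_prop (V W : lmodType (Defs.scalar R k)) (f : V -> W) x y :
  linear f -> f (x - y) = f x - f y.
Proof. by move=> fl; rewrite [x - y]addrC -scaleN1r fl scaleN1r addrC. Qed.

Lemma S_linear t : t <= T -> linear (S (T - t)).
Proof. by move=> tT; have [h _ _ _] := hS; case: (h (T - t)); rewrite ?subr_ge0. Qed.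

Lemma S_continuous t : t <= T -> continuous (S (T - t)).
Proof. by move=> tT; have [h _ _ _] := hS; case: (h (T - t)); rewrite ?subr_ge0. Qed.

Lemma B_linear : linear B.
Proof. by move=> a x y; rewrite linearP. Qed.

Lemma rinner_observation psi t z : t <= T ->
  rinner psi (S (T - t) (B z)) = rinner (observation S B T psi t) z.
Proof.
move=> tT; rewrite rinnerC.
rewrite (rinner_adjoint _ _ (S_linear tT) (S_continuous tT)).
by rewrite (rinner_adjoint _ _ B_linear hB) rinnerC.
Qed.

Lemma observation_bounded psi : exists K : R, forall t, 0 <= t -> t <= T ->
  rnorm (observation S B T psi t) <= K.
Proof.
have [M M0 hM] := semigroup_bounded hS T.
have [C C0 hC] := linear_continuous_rbounded B_linear hB.
exists (C * (M * rnorm psi)) => t t0 tT.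
apply: le_trans; first by apply: (rnorm_adjoint _ B_linear hB (ltW C0) hC).
rewrite ler_pM2l//; apply: rnorm_adjoint (ltW M0) _.
- exact: S_linear.
- exact: S_continuous.
- by move=> x; apply: hM; rewrite ?subr_ge0// gerBl.
Qed.

(** Ensures that [fine] in [L2norm] returns the true value of the integral and not the 0 assigned to
    infinity. *)
Lemma observation_integral_fin psi :
  (\int[mu]_(t in D) (rnorm (observation S B T psi t) ^+ 2)%:E < +oo)%E.
Proof.
have [K hK] := observation_bounded psi.
apply: (@le_lt_trans _ _ (\int[mu]_(t in D) (K ^+ 2)%:E)%E).
  apply: ge0_le_lower_integral => t; first by rewrite lee_fin sqr_ge0.
  rewrite /= in_itv /= => /andP[t0 tT]; rewrite lee_fin.
  have h := hK t t0 tT; rewrite ler_sqr ?nnegrE ?rnorm_ge0//.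
  exact: le_trans (rnorm_ge0 _) h.
rewrite integral_cst//=; apply: lte_mul_pinfty => //; rewrite ?lee_fin ?sqr_ge0//.
exact: itv_measure_fin.
Qed.

Lemma L2norm_ge0 (f : R -> U) : 0 <= L2norm T f.
Proof. exact: sqrtr_ge0. Qed.

Lemma L2norm_sqr (f : R -> U) :
  L2norm T f ^+ 2 = \int[mu]_(t in D) (rnorm (f t) ^+ 2).
Proof. by rewrite sqr_sqrtr//; apply: Rintegral_ge0 => t _; exact: sqr_ge0. Qed.

Lemma L2_integrable (u : R -> U) : L2 T u ->
  mu.-integrable D (EFin \o (fun t => rnorm (u t) ^+ 2)).
Proof.
move=> [mu_ fin]; apply/integrableP; split.
  apply/measurable_EFinP; apply: measurable_funX; exact: measurable_rnorm mu_.
apply: le_lt_trans fin; apply: ge0_le_lower_integral => t _ /=.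
  by rewrite lee_fin normr_ge0.
by rewrite lee_fin ger0_norm ?sqr_ge0.
Qed.

(** Dropping the negative part of f only increases its integral; the positive part lies below g,
    where monotonicity of the lower integral applies. *)
Lemma le_integral_funepos (f g : R -> R) :
  (forall t, D t -> f t <= g t) -> (forall t, D t -> 0 <= g t) ->
  (\int[mu]_(t in D) (f t)%:E <= \int[mu]_(t in D) (g t)%:E)%E.
Proof.
move=> fg g0; rewrite integralE.
apply: (@le_trans _ _ (\int[mu]_(t in D) ((fun t => (f t)%:E)^\+ t))%E).
  rewrite -[leRHS]sube0; apply: leeB => //.
  by apply: integral_ge0 => t _; exact: funeneg_ge0.
apply: ge0_le_lower_integral => t Dt; first exact: funepos_ge0.
by rewrite funeposE ge_max !lee_fin fg// g0.
Qed.

(* Integrating [0 <= |obs + c u|^2] gives a nonnegative quadratic polynomial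
   in [c]; this yields Cauchy-Schwarz without measurability of [obs]. *)
Lemma rinner_bochner_control psi (u : R -> U) v : L2 T u ->
  is_bochner_integral T (fun t => S (T - t) (B (u t))) v ->
  `|rinner psi v| <= (L2norm T u + 1) * L2norm T (observation S B T psi).
Proof.
move=> hu fv; set a := L2norm T (observation S B T psi); set b := L2norm T u.
set s := rinner psi v.
have a0 : 0 <= a by exact: L2norm_ge0.
have b0 : 0 <= b by exact: L2norm_ge0.
have [fint fE] := bochner_weak psi fv.
have uint := L2_integrable hu.
have quad (c : R) : 0 <= a ^+ 2 + 2 * c * s + c ^+ 2 * b ^+ 2.
  (* From |obs + c u|^2 >= 0, p is an integrable minorant of |obs|^2 that no longer contains
     |obs|^2. *)
  pose p (t : R) : R := - (2 * c) * rinner psi (S (T - t) (B (u t))) - c ^+ 2 * rnorm (u t) ^+ 2.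
  have i1 : mu.-integrable D
      (EFin \o (fun t => - (2 * c) * rinner psi (S (T - t) (B (u t))))).
    exact: EFin_integrableZl.
  have i2 : mu.-integrable D (EFin \o (fun t => c ^+ 2 * rnorm (u t) ^+ 2)).
    exact: EFin_integrableZl.
  have ip : \int[mu]_(t in D) p t = - (2 * c) * s - c ^+ 2 * b ^+ 2.
    by rewrite RintegralB// !RintegralZl// fE -L2norm_sqr.
  have pobs t : D t -> p t <= rnorm (observation S B T psi t) ^+ 2.
    rewrite /= in_itv /= => /andP[_ tT]; rewrite /p rinner_observation//.
    have := sqr_ge0 (rnorm (observation S B T psi t + of_real k c *: u t)).
    rewrite rnorm_sqrD rnormZ rinnerZr exprMn real_normK ?num_real// => h.
    by lra.
  have pint : mu.-integrable D (EFin \o p).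
    exact: EFin_integrableB.
  have : \int[mu]_(t in D) p t <= a ^+ 2.
    rewrite L2norm_sqr; apply: fine_le.
    - by apply: integrable_fin_num => //; exact: measurable_itv.
    - rewrite ge0_fin_numE; first exact: observation_integral_fin.
      by apply: integral_ge0 => t _; rewrite lee_fin sqr_ge0.
    - by apply: le_integral_funepos => // t _; exact: sqr_ge0.
  by rewrite ip => ?; lra.
have C0 : 0 < b + 1 by lra.
(* The minimizer of the quadratic is - s / b^2; b + 1 replaces b because b may be 0, which explains
   the factor in the conclusion. *)
have := quad (- s / (b + 1) ^+ 2).
set C := b + 1 in C0 *; have bC : b ^+ 2 <= C ^+ 2 by rewrite ler_sqr ?nnegrE /C; lra.
move=> h.
have h2 : 0 <= a ^+ 2 + 2 * (- s / C ^+ 2) * s + (- s / C ^+ 2) ^+ 2 * C ^+ 2.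
  by apply: (le_trans h); rewrite lerD2l ler_wpM2l ?sqr_ge0.
have h3 : s ^+ 2 <= (C * a) ^+ 2.
  have : 0 <= (a ^+ 2 + 2 * (- s / C ^+ 2) * s + (- s / C ^+ 2) ^+ 2 * C ^+ 2) * C ^+ 2.
    by rewrite mulr_ge0// sqr_ge0.
  have -> : (a ^+ 2 + 2 * (- s / C ^+ 2) * s + (- s / C ^+ 2) ^+ 2 * C ^+ 2) * C ^+ 2
      = (C * a) ^+ 2 - s ^+ 2 by field; rewrite gt_eqF.
  by rewrite subr_ge0.
by rewrite -ler_sqr ?nnegrE ?mulr_ge0 ?(ltW C0)// real_normK ?num_real.
Qed.

Lemma observability_of_control (y0 : X) (u : R -> U) (eps : R) : L2 T u ->
  rnorm (mild_solution S B T y0 u) <= eps ->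
  exists2 C : R, 0 < C & forall psi, rinner psi (S T y0)
    <= C * L2norm T (observation S B T psi) + eps * rnorm psi.
Proof.
move=> hu; rewrite /mild_solution.
set f := fun t => S (T - t) (B (u t)) => hy.
exists (L2norm T u + 1); first by rewrite ltr_wpDl// L2norm_ge0.
move=> psi; set v := bochner_integral T f in hy *.
have hv : `|rinner psi v| <= (L2norm T u + 1) * L2norm T (observation S B T psi).
  have [[v' fv']|nv] := pselect (exists v, is_bochner_integral T f v).
    by rewrite /v (bochner_integralE fv'); exact: rinner_bochner_control.
  (* Without a Bochner integral, [bochner_integral] takes its default 0 and the bound is trivial. *)
  have -> : v = 0.
    rewrite /v /bochner_integral; case: xgetP => // w _ fw.
    by exfalso; apply: nv; exists w.
  by rewrite rinner0r normr0 mulr_ge0 ?addr_ge0 ?L2norm_ge0.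
have -> : S T y0 = (S T y0 + v) - v by rewrite addrK.
rewrite rinnerDr rinnerNr addrC; apply: lerD.
  by apply: le_trans hv; rewrite -normrN ler_norm.
apply: (le_trans (ler_norm _)); apply: (le_trans (ler_rinner _ _)).
by rewrite mulrC ler_wpM2r ?rnorm_ge0.
Qed.

(** Existence of the Bochner integral is part of membership: linear combinations inherit it from
    [bochner_lin], and it is constructed only for controls constant on an interval. *)
Definition reachable : set X := [set v | exists u : {fimfun R >-> U},
  simple u /\ is_bochner_integral T (fun t => S (T - t) (B (u t))) v].

Lemma reachable_lin (c : R) x y : reachable x -> reachable y ->
  reachable (of_real k c *: x + y).
Proof.
move=> [u [su hu]] [u' [su' hu']].
have [q mq e] := simple_bin (fun a b => of_real k c *: a + b) su su'.
exists q; split => //; apply: bochner_ext (bochner_lin c hu hu') => t _ tT.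
by rewrite e linearP S_linear.
Qed.

Lemma bochner_interval_control (z : U) (a b : R) : 0 <= a -> b <= T ->
  exists2 v, reachable v & is_bochner_integral T
    (fun t => if t \in `[a, b]%classic then S (T - t) (B z) else 0) v.
Proof.
move=> a0 bT.
have [e e0|v hv] := @bochner_exists_restrict _ _ T X a b (fun t => S (T - t) (B z)) a0 bT.
  have [d d0 hd] := semigroup_unif_continuous hS T (B z) e0; exists d => // t s t0 tT s0 sT ts.
  apply: hd; rewrite ?subr_ge0 ?gerBl//.
  by rewrite opprB addrC addrA subrK distrC.
exists v => //.
have [u su ue] := @simple_indicator _ k U `[a, b]%classic z (measurable_itv _).
exists u; split => //; apply: bochner_ext hv => t _ tT; rewrite ue.
by case: ifP => // _; rewrite linear0 -(subrr 0) linearB_prop ?subrr//; exact: S_linear.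
Qed.

Lemma reachable0 : reachable 0.
Proof.
have [v rv _] := @bochner_interval_control 0 0 T (lexx _) (lexx _).
by have := reachable_lin (-1) rv rv; rewrite of_realN of_real1 scaleN1r addNr.
Qed.

(** A positive value c at t0 would keep the pairing above c / 2 on an interval around t0. The
    control equal to z on that interval would then reach a state v with <w, v> > 0. *)
Lemma rinner_orthogonal_le0 (w : X) (z : U) (t0 : R) :
  (forall m, reachable m -> rinner w m = 0) -> 0 <= t0 -> t0 <= T ->
  rinner w (S (T - t0) (B z)) <= 0.
Proof.
move=> wr t00 t0T; rewrite leNgt; apply/negP; set c := rinner _ _ => c0.
have w1 : 0 < rnorm w + 1 by rewrite ltr_wpDl ?rnorm_ge0.
have [d d0 hd] := semigroup_unif_continuous hS T (B z)
  (divr_gt0 (divr_gt0 c0 (ltr0Sn R 1)) w1).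
(* Half-width d / 2, so that points of the closed interval stay at distance strictly less than d
   from t0. *)
pose a := Num.max 0 (t0 - d / 2); pose b := Num.min T (t0 + d / 2).
have a0 : 0 <= a by rewrite le_max lexx.
have bT : b <= T by rewrite ge_min lexx.
have ab : a < b by exact: clipped_interval_lt.
have [v rv fv] := bochner_interval_control z a0 bT.
have [fint fE] := bochner_weak w fv.
have := wr _ rv; rewrite -fE => I0.
have : \int[mu]_(t in D) (c / 2 * \1_(`[a, b]%classic) t) <= 0.
  rewrite -[leRHS]I0; apply: le_Rintegral => //.
  - by apply: EFin_integrableZl; apply: indic_integrable; exact: measurable_itv.
  - move=> t; rewrite /= in_itv /= => /andP[t_0 tT]; rewrite indicE.
    case: ifPn => [tab|_] /=; last by rewrite mulr0 rinner0r.
    rewrite mulr1.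
    move: tab; rewrite inE /= in_itv /= ge_max le_min => /andP[/andP[_ h1] /andP[_ h2]].
    have : rnorm (S (T - t0) (B z) - S (T - t) (B z)) <= c / 2 / (rnorm w + 1).
      apply: hd; rewrite ?subr_ge0 ?gerBl//.
      rewrite opprB addrC addrA subrK ltr_distl.
      have d2 : d / 2 < d by rewrite ltr_pdivrMr// ltr_pMr// ltr1n.
      apply/andP; split; first by apply: lt_le_trans h1; rewrite ltrD2l ltrN2.
      by apply: (le_lt_trans h2); rewrite ltrD2l.
    rewrite ler_pdivlMr// => h3.
    have := ler_rinner w (S (T - t0) (B z) - S (T - t) (B z)).
    rewrite rinnerDr rinnerNr -/c => h4.
    have := le_trans (ler_norm _) h4; have := rnorm_ge0 (S (T - t0) (B z) - S (T - t) (B z)).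
    move: (rnorm _) h3 => n h3 n0 h5.
    have : rnorm w * n <= n * (rnorm w + 1) by rewrite mulrC ler_wpM2l// lerDl.
    by move=> h6; lra.
rewrite RintegralZl//; last by apply: indic_integrable; exact: measurable_itv.
rewrite /Rintegral integral_indic; last 2 first.
  exact: measurable_itv.
  exact: measurable_itv.
rewrite (_ : `[a, b]%classic `&` D = `[a, b]%classic); last first.
  apply/seteqP; split => t /=; first by case.
  rewrite !in_itv /= => /andP[h1 h2]; split; apply/andP; split => //.
    exact: le_trans a0 h1.
  exact: le_trans h2 bT.
have mab : fine (mu `[a, b]%classic) = b - a.
  by rewrite lebesgue_measure_itv /= lte_fin ab.
move=> h; have : 0 < c / 2 * (b - a) by rewrite mulr_gt0 ?divr_gt0 ?subr_gt0.
by rewrite -mab ltNge => /negP; apply; exact: h.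
Qed.

(** Taking the observation itself for z turns the pairing in [rinner_orthogonal_le0] into the
    squared norm of the observation. *)
Lemma observation_orthogonal (w : X) :
  (forall m, reachable m -> rinner w m = 0) ->
  L2norm T (observation S B T w) = 0.
Proof.
move=> wr.
have obs0 t : D t -> observation S B T w t = 0.
  rewrite /= in_itv /= => /andP[t0 tT].
  apply/eqP; rewrite -rnorm_eq0 -sqrf_eq0 -rinnerxx -rinner_observation//.
  apply/eqP/le_anti/andP; split; first exact: rinner_orthogonal_le0.
  rewrite -oppr_le0 -rinnerNr -[X in rinner _ X](_ : S (T - t) (B (- observation S B T w t)) = _).
    exact: rinner_orthogonal_le0.
  rewrite linearN -sub0r linearB_prop; last exact: S_linear.
  by rewrite -[X in S _ X - _](subrr 0) linearB_prop ?subrr ?sub0r//; exact: S_linear.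
rewrite /L2norm (_ : Rintegral _ _ _ = 0) ?sqrtr0//.
rewrite -[RHS](@mul0r _ (fine (mu D))) -Rintegral_cst//.
apply: eq_Rintegral => t; rewrite inE => Dt.
by rewrite obs0// rnorm0 expr0n.
Qed.

Lemma simple_L2 (u : {fimfun R >-> U}) : simple u -> L2 T u.
Proof.
move=> su; split; first exact: simple_strongly_measurable.
have [M M0 hM] := simple_bounded u.
apply: (@le_lt_trans _ _ (\int[mu]_(t in D) (M ^+ 2)%:E)%E).
  apply: ge0_le_lower_integral => t _; first by rewrite lee_fin sqr_ge0.
  by rewrite lee_fin ler_sqr ?nnegrE ?rnorm_ge0.
rewrite integral_cst//=; apply: lte_mul_pinfty => //; rewrite ?lee_fin ?sqr_ge0//.
exact: itv_measure_fin.
Qed.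

Lemma control_of_observability (y0 : X) (eps : R) : 0 < eps ->
  (forall alpha : R, 0 < alpha ->
     exists C : R, 0 < C /\ observability S B T y0 alpha C) ->
  exists u : R -> U, L2 T u /\ rnorm (mild_solution S B T y0 u) <= eps.
Proof.
move=> eps0 hobs; set z := S T y0.
have [w [wr hw]] := @orthogonal_projection _ _ _ reachable z reachable0
  (fun x y hx hy => ltac:(by have := reachable_lin 1 hx hy; rewrite of_real1 scale1r))
  (fun a x hx => ltac:(by have := reachable_lin a hx reachable0; rewrite addr0)).
have e20 : 0 < eps / 2 by rewrite divr_gt0.
have y1 : 0 < rnorm y0 + 1 by rewrite ltr_wpDl ?rnorm_ge0.
have wle : rnorm w <= eps / 2.
  have [->|w0] := eqVneq (rnorm w) 0; first exact: ltW.
  have wp : 0 < rnorm w by rewrite lt0r w0 rnorm_ge0.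
  (* With alpha = (eps / 2) / (|y0| + 1), alpha |y0| <= eps / 2 even when y0 = 0. *)
  have [C [C0 hC]] := hobs _ (divr_gt0 e20 y1).
  have := hC w; rewrite observation_orthogonal// mulr0 add0r -/z => h1.
  have h2 : rinner w z <= eps / 2 * rnorm w.
    apply: (le_trans h1); rewrite ler_wpM2r ?rnorm_ge0//.
    by rewrite mulrAC ler_pdivrMr// ler_wpM2l ?(ltW e20)// lerDl.
  (* z = w + m + error with <w, m> = 0; an error of norm at most e / |w| costs at most e in the
     pairing. *)
  have h3 : rnorm w ^+ 2 <= rinner w z.
    apply/ler_addgt0Pr => e e0; have [m rm hm] := hw _ (divr_gt0 e0 wp).
    have h4 : z = w + m + (z - m - w).
      by rewrite [RHS]addrC addrA !subrK.
    rewrite [X in rinner w X]h4 !rinnerDr (wr _ rm) rinnerxx addr0 -addrA lerDl.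
    have := ler_rinner w (z - m - w).
    rewrite ler_pdivlMr// mulrC in hm => h5.
    have := le_trans h5 hm; rewrite ler_norml => /andP[h6 _].
    by rewrite -!rinnerDr; lra.
  by have := le_trans h3 h2; rewrite expr2 ler_pM2r.
have [m rm hm] := hw _ e20.
(* The control must reach -m, since the final state is z plus the reached state and z - m is close
   to w. *)
have := reachable_lin (-1) rm reachable0.
rewrite addr0 of_realN of_real1 scaleN1r => -[u [su hu]].
exists u; split; first exact: simple_L2.
rewrite /mild_solution (bochner_integralE hu).
have := ler_rnorm_add (z - m) w; rewrite -/z => h.
by apply: (le_trans h); rewrite [leRHS]splitr; exact: lerD.
Qed.

End control.

(** * The observability cost *)

Section cost.
Context (R : realType) (k : scalar_kind) (X U : hilbertType R k).
Context (S : R -> X -> X) (B : U -> X) (T : R) (y0 : X) (alpha : R).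

Let obs C : observability S B T y0 alpha C <->
  forall psi, rinner psi (S T y0) - alpha * rnorm y0 * rnorm psi
    <= C * L2norm T (observation S B T psi).
Proof. by split=> h psi; [rewrite lerBlDr|rewrite -lerBlDr]; exact: h. Qed.

Lemma observability_mono C C' : C <= C' ->
  observability S B T y0 alpha C -> observability S B T y0 alpha C'.
Proof.
move=> CC' h psi; apply: (le_trans (h psi)).
by rewrite lerD2r ler_wpM2r// sqrtr_ge0.
Qed.

Lemma mu_cost_ltyP : (mu_cost S B T y0 alpha < +oo)%E <->
  exists C : R, 0 < C /\ observability S B T y0 alpha C.
Proof.
split=> [/ereal_inf_lt[_ [C [C0 /obs hC] <-] _]|[C [C0 hC]]].
  (* The infimum ranges over C >= 0, whereas (iii) asks for C > 0. *)
  exists (C + 1); split; first by rewrite ltr_wpDl.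
  by apply: observability_mono hC; rewrite lerDl.
apply: (@le_lt_trans _ _ C%:E); last by rewrite ltry.
by apply: ereal_inf_lbound; exists C => //; split; [exact: ltW|exact/obs].
Qed.

(** For each psi the inequality is closed in C, so it passes from admissible constants arbitrarily
    close to the infimum to the infimum itself. *)
Lemma mu_cost_attained : (mu_cost S B T y0 alpha < +oo)%E ->
  exists C : R, [/\ mu_cost S B T y0 alpha = C%:E, 0 <= C,
    observability S B T y0 alpha C
    & forall C' : R, 0 <= C' -> observability S B T y0 alpha C' -> C <= C'].
Proof.
move=> fin; have mu0 : (0 <= mu_cost S B T y0 alpha)%E.
  by apply: le_ereal_inf_tmp => _ [C [C0 _] <-]; rewrite lee_fin.
have [C CE] : exists C : R, mu_cost S B T y0 alpha = C%:E.
  by exists (fine (mu_cost S B T y0 alpha)); rewrite fineK// ge0_fin_numE.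
have C0 : 0 <= C by rewrite -lee_fin -CE.
have Cmin C' : 0 <= C' -> observability S B T y0 alpha C' -> C <= C'.
  move=> C'0 /obs hC'; rewrite -lee_fin -CE.
  by apply: ereal_inf_lbound; exists C'.
exists C; split => //; apply/obs => psi.
set L := L2norm T _; have L0 : 0 <= L by exact: sqrtr_ge0.
apply/ler_addgt0Pr => e e0.
have L1 : 0 < L + 1 by rewrite ltr_wpDl.
have : (mu_cost S B T y0 alpha < (C + e / (L + 1))%:E)%E.
  by rewrite CE lte_fin ltrDl divr_gt0.
move=> /ereal_inf_lt[_ [C' [C'0 hC'] <-]]; rewrite lte_fin => C'C.
apply: (le_trans (hC' psi)); rewrite -/L.
apply: (@le_trans _ _ ((C + e / (L + 1)) * L)); first by rewrite ler_wpM2r// ltW.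
by rewrite mulrDl lerD2l mulrAC ler_pdivrMr// ler_wpM2l ?(ltW e0)// lerDl.
Qed.

End cost.

Theorem theorem2 (R : realType) (k : scalar_kind) (X U : hilbertType R k)
    (D : set X) (A : X -> X) (S : R -> X -> X) (hA : generates D A S)
    (B : {linear U -> X}) (hB : continuous B) (T : R) (hT : 0 < T) :
  let P1 := approx_null_controllable S B T in
  let P2 := forall (y0 : X) (alpha : R), 0 < alpha ->
              (mu_cost S B T y0 alpha < +oo)%E in
  let P3 := forall (y0 : X) (alpha : R), 0 < alpha ->
              exists C : R, 0 < C /\ observability S B T y0 alpha C in
  [/\ P1 <-> P2,
      P2 <-> P3
    & P1 \/ P2 \/ P3 ->
      forall (y0 : X) (alpha : R), 0 < alpha ->
        exists C : R,
          [/\ mu_cost S B T y0 alpha = C%:E,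
              0 <= C,
              observability S B T y0 alpha C
            & forall C' : R, 0 <= C' -> observability S B T y0 alpha C' ->
                C <= C']].
Proof.
move=> P1 P2 P3; have [hS _ _] := hA.
have P23 : P2 <-> P3.
  by split=> h y0 alpha a0; [apply/mu_cost_ltyP|apply/mu_cost_ltyP]; exact: h.
have P13 : P1 <-> P3.
  split=> [h y0 alpha a0|h eps y0 eps0]; last first.
    by apply: control_of_observability => // alpha; exact: h.
  (* The tolerance alpha |y0| must be positive to apply (i); for y0 = 0 the inequality holds with C
     = 1. *)
  have [y00|y00] := eqVneq (rnorm y0) 0.
    exists 1; split => // psi; have /eqP -> : y0 == 0 by rewrite -rnorm_eq0 y00.
    have -> : S T 0 = 0.
      have [/(_ T (ltW hT))[Sl _] _ _ _] := hS.
      by rewrite -[X in S T X](subrr 0) (linearB_prop _ _ Sl) subrr.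
    by rewrite rinner0r rnorm0 mulr0 mul0r addr0 mul1r sqrtr_ge0.
  have ay0 : 0 < alpha * rnorm y0 by rewrite mulr_gt0// lt0r y00 rnorm_ge0.
  have [u [hu uy]] := h _ y0 ay0.
  have [C C0 hC] := observability_of_control hS hB hu uy.
  by exists C.
split=> //; first by rewrite P13 P23.
move=> h y0 alpha a0; apply: mu_cost_attained.
suff : P2 by apply.
by case: h => [/P13/P23|[|/P23]].
Qed.
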